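(* For any odd prime $p$, the group $\Lambda_p$ generated by the image of $S_p$ in $PGU_3(\mathbb{Z}[1/p])$ acts simply-transitively on the special vertices of the Bruhat–Tits building associated with $PGU_3(\mathbb{Q}_p)$.
   Context: $\mathbb{Z}[i]$ is the Gaussian integers, $A^*$ the conjugate transpose. For a commutative ring $R$, $PGU_3(R)=\{g\in GL_3(R[\sqrt{-1}]) : gg^*=\lambda I,\ \lambda\in R^\times\}/R[\sqrt{-1}]^\times$. $p'=p$ if $p\equiv 1\pmod 4$, $p'=p^2$ if $p\equiv 3\pmod 4$. $S_p=\{A\in M_3(\mathbb{Z}[i]) : AA^*=p'I,\ A \text{ not scalar},\ A_{11}\equiv A_{22}\equiv A_{33}\equiv 1 \pmod{2+2i}\}$. The special vertices of the building of $PGU_3(\mathbb{Q}_p)$ are identified with $PGU_3(\mathbb{Q}_p)/PGU_3(\mathbb{Z}_p)$: for $p\equiv1\pmod 4$, $PGU_3(\mathbb{Q}_p)\cong PGL_3(\mathbb{Q}_p)$ and all vertices of its 2-dimensional building are special; for $p\equiv 3\pmod4$ the building is a $(p^3+1,p+1)$-biregular tree whose special vertices are those of degree $p^3+1$. *)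

(* Defs.v *)
From HB Require Import structures.
From mathcomp Require Import all_boot all_order all_algebra.
Set Implicit Arguments. Unset Strict Implicit. Unset Printing Implicit Defensive.
Import Order.TTheory GRing.Theory Num.Theory.
Local Open Scope ring_scope.

(* 3x3 matrices over R[sqrt(-1)] = R[x]/(x^2+1), for R a commutative   *)
(* ring, written out as pairs (A, B) standing for A + sqrt(-1) B.      *)
Definition gmx (R : comNzRingType) := ('M[R]_3 * 'M[R]_3)%type.

Section Gauss.
Variable R : comNzRingType.

Definition gmul (g h : gmx R) : gmx R :=
  (g.1 *m h.1 - g.2 *m h.2, g.1 *m h.2 + g.2 *m h.1).
Definition gstar (g : gmx R) : gmx R := (g.1^T, - g.2^T).
Definition gone : gmx R := (1%:M, 0).
Definition gscal (l : R) : gmx R := (l%:M, 0).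
Definition cmul (c d : R * R) : R * R :=
  (c.1 * d.1 - c.2 * d.2, c.1 * d.2 + c.2 * d.1).
Definition gsc (c : R * R) (g : gmx R) : gmx R :=
  (c.1 *: g.1 - c.2 *: g.2, c.1 *: g.2 + c.2 *: g.1).

(* S : R -> Prop is a subring of R (Z_p inside Q_p, Z[1/p] inside Q, or all of R) *)
Definition in_S_mx (S : R -> Prop) (g : gmx R) :=
  forall i j, S (g.1 i j) /\ S (g.2 i j).
Definition S_unit (S : R -> Prop) (x : R) := S x /\ exists y, S y /\ x * y = 1.
Definition gauss_unit (S : R -> Prop) (c : R * R) :=
  S c.1 /\ S c.2 /\ exists d : R * R, S d.1 /\ S d.2 /\ cmul c d = (1, 0).
(* GU_3(S) = { g in GL_3(S[i]) : g g^* = l I, l in S^x }.  (Invertibility of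
   g over S[i] is automatic: g^{-1} = l^{-1} g^*.) *)
Definition GU (S : R -> Prop) (g : gmx R) :=
  in_S_mx S g /\ exists l, S_unit S l /\ gmul g (gstar g) = gscal l.
Definition PGU_eq (S : R -> Prop) (g h : gmx R) :=
  exists c, gauss_unit S c /\ h = gsc c g.
End Gauss.

Definition gmap (R1 R2 : comNzRingType) (f : R1 -> R2) (g : gmx R1) : gmx R2 :=
  (map_mx f g.1, map_mx f g.2).

(* The field Q_p, characterised (up to unique isomorphism) as a        *)
(* complete valued field K with a dense copy of Q, whose valuation     *)
(* v : K -> int (value at 0 irrelevant) satisfies v(p) = 1.            *)
Definition val_ge (K : fieldType) (v : K -> int) (x : K) (n : int) :=
  x = 0 \/ n <= v x.

Definition is_Qp (p : nat) (K : fieldType) (iota : {rmorphism rat -> K})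
    (v : K -> int) : Prop :=
  [/\ (forall x y : K, x != 0 -> y != 0 -> v (x * y) = v x + v y),
      (forall (x y : K) n, val_ge v x n -> val_ge v y n -> val_ge v (x + y) n),
      v (iota p%:R) = 1,
      (forall (x : K) (n : int), exists q : rat, val_ge v (x - iota q) n) &
      (forall s : nat -> K,
         (forall n : int, exists N, forall m, (N <= m)%N -> val_ge v (s m.+1 - s m) n) ->
         exists l, forall n : int, exists N, forall m, (N <= m)%N -> val_ge v (s m - l) n)].

Definition Zp (K : fieldType) (v : K -> int) (x : K) : Prop := val_ge v x 0.
Definition Zinv (p : nat) (x : rat) : Prop :=
  exists (z : int) (k : nat), x = z%:~R / (p ^ k)%:R.

(* special vertices PGU_3(Q_p)/PGU_3(Z_p): g, h in GU_3(Q_p) give the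
   same vertex iff [h] in [g] . PGU_3(Z_p). *)
Definition vertex_eq (K : fieldType) (v : K -> int) (g h : gmx K) :=
  exists c k, gauss_unit (fun _ : K => True) c /\ GU (Zp v) k /\ h = gsc c (gmul g k).

Definition pprime (p : nat) : nat := if (p %% 4 == 1)%N then p else (p ^ 2)%N.

(* a + b i == 1 (mod 2 + 2i) in Z[i] *)
Definition cong1 (a b : int) :=
  exists x y : int, a - 1 = 2 * x - 2 * y /\ b = 2 * x + 2 * y.

Definition in_Sp (p : nat) (A : gmx int) :=
  [/\ gmul A (gstar A) = gscal (pprime p)%:Z,
      ~ (exists a b : int, A = (a%:M, b%:M)) &
      forall i : 'I_3, cong1 (A.1 i i) (A.2 i i)].

Definition int2rat (z : int) : rat := z%:~R.

(* Lam p gam : gam in GU_3(Z[1/p]) represents an element of the subgroup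
   Lambda_p of PGU_3(Z[1/p]) generated by the image of S_p.  (The inverse
   of [x] in PGU_3 is [x^*], as x x^* is a scalar unit.) *)
Inductive Lam (p : nat) : gmx rat -> Prop :=
| Lam_gen A : in_Sp p A -> Lam p (gmap int2rat A)
| Lam_one : Lam p (gone rat)
| Lam_mul x y : Lam p x -> Lam p y -> Lam p (gmul x y)
| Lam_inv x : Lam p x -> Lam p (gstar x)
| Lam_eq x y : Lam p x -> PGU_eq (Zinv p) x y -> Lam p y.

(* Main.v *)
Require Import Defs.
From HB Require Import structures.
From mathcomp Require Import all_boot all_order all_algebra.
From mathcomp Require Import all_fingroup finfield.
From mathcomp Require Import ring lra zify.
From Stdlib Require Import Classical.
Set Implicit Arguments. Unset Strict Implicit. Unset Printing Implicit Defensive.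
Import Order.TTheory GRing.Theory Num.Theory.
Local Open Scope ring_scope.

(* A vertex is a lattice in K[i]^3, and its trace L on Z[i]^3 satisfies
   L = {x | p^e divides y^* x for all y in L}.  For any q, such a q-selfdual lattice
   has the form A Z[i]^3 with A A^* = q: the Gram matrix of a basis, divided by q, is
   hermitian, positive definite, of determinant 1, and Hermite reduction brings it to
   the identity (class number one).  So every vertex is represented by an integral A
   with A A^* = p^e.

   Applied to a second selfdual lattice squeezed between A Z[i]^3 and Z[i]^3, the same
   result splits off a left factor B of A with B B^* = p' (p for p = 1 mod 4, where
   Z[i]/p = F_p x F_p; p^2 for p = 3 mod 4).  Modulo 1 + i a suitable product B W with
   W monomial has odd diagonal, which can then be normalized to be 1 mod 2 + 2i, so
   B W is scalar or lies in S_p.  By induction on e, A is a product of elements of S_p,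
   up to scalars and integral unitary matrices; this is transitivity.

   For freeness, the integral similitudes with diagonal 1 mod 2 + 2i and norm 1 mod 4
   are closed under products.  If such an A with A A^* = q fixes the base vertex, then
   q divides all A_ij conj(A_kl); as each row has norm q, A is diagonal, and the
   quotients of its diagonal entries are units congruent to 1 mod 2 + 2i, hence 1. *)

(** * Gaussian rings *)

(** A record rather than a pair, because pairs of rings already carry the componentwise product. The
    ring built below is [R[x]/(x^2+1)], which has zero divisors when -1 is a square in [R]. *)
Record gauss (R : Type) := Gauss { gre : R; gim : R }.

Definition pair_of_gauss R (x : gauss R) := (gre x, gim x).
Definition gauss_of_pair R (x : R * R) := Gauss x.1 x.2.
Lemma gaussK R : cancel (@pair_of_gauss R) (@gauss_of_pair R).
Proof. by case. Qed.

HB.instance Definition _ (R : choiceType) :=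
  Choice.copy (gauss R) (can_type (@gaussK R)).

Section GaussRing.
Variable R : comNzRingType.
Implicit Types x y z : gauss R.

Lemma gaussP x y : gre x = gre y -> gim x = gim y -> x = y.
Proof. by case: x y => [a b] [c d] /= -> ->. Qed.

Definition gadd x y := Gauss (gre x + gre y) (gim x + gim y).
Definition gopp x := Gauss (- gre x) (- gim x).
Definition gzero : gauss R := Gauss 0 0.
Definition gunit : gauss R := Gauss 1 0.
Definition gtimes x y :=
  Gauss (gre x * gre y - gim x * gim y) (gre x * gim y + gim x * gre y).

Lemma gaddA : associative gadd.
Proof. by move=> x y z; apply: gaussP => /=; ring. Qed.
Lemma gaddC : commutative gadd.
Proof. by move=> x y; apply: gaussP => /=; ring. Qed.
Lemma gadd0 : left_id gzero gadd.
Proof. by move=> x; apply: gaussP => /=; ring. Qed.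
Lemma gaddN : left_inverse gzero gopp gadd.
Proof. by move=> x; apply: gaussP => /=; ring. Qed.
HB.instance Definition _ := GRing.isZmodule.Build (gauss R) gaddA gaddC gadd0 gaddN.

Lemma gtimesA : associative gtimes.
Proof. by move=> x y z; apply: gaussP => /=; ring. Qed.
Lemma gtimesC : commutative gtimes.
Proof. by move=> x y; apply: gaussP => /=; ring. Qed.
Lemma gtimes1 : left_id gunit gtimes.
Proof. by move=> x; apply: gaussP => /=; ring. Qed.
Lemma gtimesD : left_distributive gtimes gadd.
Proof. by move=> x y z; apply: gaussP => /=; ring. Qed.
Lemma gunit_neq0 : gunit != gzero.
Proof. by apply/eqP => -[] /eqP; rewrite oner_eq0. Qed.
HB.instance Definition _ :=
  GRing.Zmodule_isComNzRing.Build (gauss R) gtimesA gtimesC gtimes1 gtimesD gunit_neq0.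

Lemma greD x y : gre (x + y) = gre x + gre y. Proof. by []. Qed.
Lemma gimD x y : gim (x + y) = gim x + gim y. Proof. by []. Qed.
Lemma greN x : gre (- x) = - gre x. Proof. by []. Qed.
Lemma gimN x : gim (- x) = - gim x. Proof. by []. Qed.
Lemma greM x y : gre (x * y) = gre x * gre y - gim x * gim y. Proof. by []. Qed.
Lemma gimM x y : gim (x * y) = gre x * gim y + gim x * gre y. Proof. by []. Qed.
Lemma gre0 : gre (0 : gauss R) = 0. Proof. by []. Qed.
Lemma gim0 : gim (0 : gauss R) = 0. Proof. by []. Qed.
Lemma gre1 : gre (1 : gauss R) = 1. Proof. by []. Qed.
Lemma gim1 : gim (1 : gauss R) = 0. Proof. by []. Qed.

Definition gC (r : R) : gauss R := Gauss r 0.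
Definition gbar x : gauss R := Gauss (gre x) (- gim x).
Definition gN x : R := gre x ^+ 2 + gim x ^+ 2.

Lemma greC r : gre (gC r) = r. Proof. by []. Qed.
Lemma gimC r : gim (gC r) = 0. Proof. by []. Qed.
Lemma gre_bar x : gre (gbar x) = gre x. Proof. by []. Qed.
Lemma gim_bar x : gim (gbar x) = - gim x. Proof. by []. Qed.
Definition gE := (greC, gimC, gre_bar, gim_bar, greD, gimD, greN, gimN, greM,
  gimM, gre0, gim0, gre1, gim1).

Fact gC_zmod : zmod_morphism gC.
Proof. by move=> x y; apply: gaussP; rewrite ?gE ?subr0. Qed.
Fact gC_monoid : monoid_morphism gC.
Proof. by split=> // x y; apply: gaussP; rewrite ?gE; ring. Qed.
HB.instance Definition _ := GRing.isZmodMorphism.Build R (gauss R) gC gC_zmod.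
HB.instance Definition _ := GRing.isMonoidMorphism.Build R (gauss R) gC gC_monoid.

Fact gbar_zmod : zmod_morphism gbar.
Proof. by move=> x y; apply: gaussP; rewrite !gE; ring. Qed.
Fact gbar_monoid : monoid_morphism gbar.
Proof. by split=> [|x y]; apply: gaussP; rewrite ?gE //; ring. Qed.
HB.instance Definition _ := GRing.isZmodMorphism.Build (gauss R) (gauss R) gbar gbar_zmod.
HB.instance Definition _ := GRing.isMonoidMorphism.Build (gauss R) (gauss R) gbar gbar_monoid.

Fact gre_zmod : zmod_morphism (@gre R). Proof. by []. Qed.
HB.instance Definition _ := GRing.isZmodMorphism.Build (gauss R) R (@gre R) gre_zmod.
Fact gim_zmod : zmod_morphism (@gim R). Proof. by []. Qed.
HB.instance Definition _ := GRing.isZmodMorphism.Build (gauss R) R (@gim R) gim_zmod.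

Lemma gbarK : involutive gbar.
Proof. by move=> x; apply: gaussP; rewrite !gE; ring. Qed.
Lemma gbarC r : gbar (gC r) = gC r.
Proof. by apply: gaussP; rewrite !gE; ring. Qed.
Lemma mul_gbar x : x * gbar x = gC (gN x).
Proof. by apply: gaussP; rewrite !gE /gN; ring. Qed.
Lemma gNM x y : gN (x * y) = gN x * gN y.
Proof. by rewrite /gN !gE; ring. Qed.
Lemma gN_bar x : gN (gbar x) = gN x.
Proof. by rewrite /gN !gE; ring. Qed.
Lemma gC_inj : injective gC. Proof. by move=> a b []. Qed.
Lemma gNC r : gN (gC r) = r ^+ 2.
Proof. by rewrite /gN !gE; ring. Qed.

Definition mxstar m n (A : 'M[gauss R]_(m, n)) := (map_mx gbar A)^T.

Lemma mxstarE m n (A : 'M_(m, n)) i j : mxstar A i j = gbar (A j i).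
Proof. by rewrite !mxE. Qed.
Lemma mxstarK m n (A : 'M_(m, n)) : mxstar (mxstar A) = A.
Proof. by apply/matrixP => i j; rewrite !mxstarE gbarK. Qed.
Lemma mxstarM m n k (A : 'M_(m, n)) (B : 'M_(n, k)) :
  mxstar (A *m B) = mxstar B *m mxstar A.
Proof. by rewrite /mxstar map_mxM trmx_mul. Qed.
Lemma mxstar_scalar n a : mxstar (a%:M : 'M_n) = (gbar a)%:M.
Proof. by rewrite /mxstar map_scalar_mx tr_scalar_mx. Qed.
Lemma mxstarZ m n a (A : 'M_(m, n)) : mxstar (a *: A) = gbar a *: mxstar A.
Proof. by apply/matrixP => i j; rewrite !mxE rmorphM. Qed.
Lemma det_mxstar n (A : 'M_n) : \det (mxstar A) = gbar (\det A).
Proof. by rewrite /mxstar det_tr det_map_mx. Qed.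

End GaussRing.

Notation "A ^h" := (mxstar A) (at level 2, format "A ^h") : ring_scope.

Section GaussMap.
Variables (R S : comNzRingType) (f : {rmorphism R -> S}).
Definition gmapc (x : gauss R) : gauss S := Gauss (f (gre x)) (f (gim x)).
Fact gmapc_zmod : zmod_morphism gmapc.
Proof. by move=> x y; apply: gaussP; rewrite /gmapc /= rmorphB. Qed.
Fact gmapc_monoid : monoid_morphism gmapc.
Proof.
split=> [|x y]; apply: gaussP; rewrite /gmapc ?gE /= ?rmorph1 ?rmorph0 //.
  by rewrite rmorphB !rmorphM.
by rewrite rmorphD !rmorphM.
Qed.
HB.instance Definition _ := GRing.isZmodMorphism.Build (gauss R) (gauss S) gmapc gmapc_zmod.
HB.instance Definition _ := GRing.isMonoidMorphism.Build (gauss R) (gauss S) gmapc gmapc_monoid.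
Lemma gmapc_bar x : gmapc (gbar x) = gbar (gmapc x).
Proof. by apply: gaussP; rewrite /= ?rmorphN. Qed.
Lemma gmapcC r : gmapc (gC r) = gC (f r).
Proof. by apply: gaussP; rewrite /= ?rmorph0. Qed.
Lemma map_mxstar m n (A : 'M[gauss R]_(m, n)) : map_mx gmapc A^h = (map_mx gmapc A)^h.
Proof. by apply/matrixP => i j; rewrite !mxE gmapc_bar. Qed.
End GaussMap.

(** * Translation between pairs of matrices over [R] and matrices over [gauss R] *)

Section Translate.
Variable R : comNzRingType.
Definition toM (g : gmx R) : 'M[gauss R]_3 := \matrix_(i, j) Gauss (g.1 i j) (g.2 i j).
Definition ofM (A : 'M[gauss R]_3) : gmx R :=
  (\matrix_(i, j) gre (A i j), \matrix_(i, j) gim (A i j)).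
Lemma toMK : cancel toM ofM.
Proof. by case=> A B; congr pair; apply/matrixP => i j; rewrite !mxE. Qed.
Lemma ofMK : cancel ofM toM.
Proof. by move=> A; apply/matrixP => i j; rewrite !mxE; apply: gaussP. Qed.
Lemma toM_mul g h : toM (gmul g h) = toM g *m toM h.
Proof.
apply/matrixP => i j; rewrite !mxE; apply: gaussP.
  rewrite [RHS]raddf_sum /= -sumrN -big_split /=.
  by apply: eq_bigr => k _; rewrite !mxE.
rewrite [RHS]raddf_sum /= -big_split /=.
by apply: eq_bigr => k _; rewrite !mxE.
Qed.
Lemma toM_star g : toM (gstar g) = (toM g)^h.
Proof. by apply/matrixP => i j; rewrite !mxE; apply: gaussP. Qed.
Lemma toM_scal l : toM (gscal l) = (gC l)%:M.
Proof. by apply/matrixP => i j; rewrite !mxE; case: eqP => _; apply: gaussP; rewrite !gE. Qed.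
Lemma toM_one : toM (gone R) = 1%:M.
Proof. exact: (toM_scal 1). Qed.
Lemma toM_sc c g : toM (gsc c g) = Gauss c.1 c.2 *: toM g.
Proof. by apply/matrixP => i j; rewrite !mxE; apply: gaussP. Qed.
End Translate.

Lemma toM_map (R S : comNzRingType) (f : {rmorphism R -> S}) g :
  toM (gmap f g) = map_mx (gmapc f) (toM g).
Proof. by apply/matrixP => i j; rewrite !mxE; apply: gaussP. Qed.

(** * Reduction of unimodular hermitian forms *)

Definition o0 : 'I_3 := ord0.
Definition o1 : 'I_3 := @Ordinal 3 1 isT.
Definition o2 : 'I_3 := @Ordinal 3 2 isT.

Lemma sum3 (V : nmodType) (F : 'I_3 -> V) : \sum_i F i = F o0 + F o1 + F o2.
Proof.
rewrite !big_ord_recl big_ord0 addr0 addrA.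
by congr (F _ + F _ + F _); apply: val_inj.
Qed.

Lemma forall3 (P : 'I_3 -> Prop) : P o0 -> P o1 -> P o2 -> forall i, P i.
Proof.
move=> P0 P1 P2 [[|[|[|//]]] lti].
- by rewrite (_ : Ordinal lti = o0) //; apply: val_inj.
- by rewrite (_ : Ordinal lti = o1) //; apply: val_inj.
- by rewrite (_ : Ordinal lti = o2) //; apply: val_inj.
Qed.

Lemma det_mx2 (R : comNzRingType) (A : 'M[R]_2) :
  \det A = A ord0 ord0 * A ord_max ord_max - A ord0 ord_max * A ord_max ord0.
Proof.
rewrite (expand_det_row A ord0) !big_ord_recl big_ord0 /cofactor !det_mx11 !mxE.
have -> : lift ord0 ord0 = ord_max :> 'I_2 by apply: val_inj.
have -> : lift ord_max ord0 = ord0 :> 'I_2 by apply: val_inj.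
rewrite /=; ring.
Qed.

Lemma det3 (R : comNzRingType) (A : 'M[R]_3) :
  \det A = A o0 o0 * (A o1 o1 * A o2 o2 - A o1 o2 * A o2 o1)
         - A o0 o1 * (A o1 o0 * A o2 o2 - A o1 o2 * A o2 o0)
         + A o0 o2 * (A o1 o0 * A o2 o1 - A o1 o1 * A o2 o0).
Proof.
rewrite (expand_det_row A o0) sum3 /cofactor !det_mx2 !mxE.
have E k l : A (lift o0 k) l = A (if k == 0 then o1 else o2) l.
  by case: k => [[|[|//]] ?]; congr (A _ _); apply: val_inj.
have E0 k l : A k (lift o0 l) = A k (if l == 0 then o1 else o2).
  by case: l => [[|[|//]] ?]; congr (A _ _); apply: val_inj.
have E1 k l : A k (lift o1 l) = A k (if l == 0 then o0 else o2).
  by case: l => [[|[|//]] ?]; congr (A _ _); apply: val_inj.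
have E2 k l : A k (lift o2 l) = A k (if l == 0 then o0 else o1).
  by case: l => [[|[|//]] ?]; congr (A _ _); apply: val_inj.
rewrite !E0 !E1 !E2 !E /=; ring.
Qed.

Definition mk3 (R : nmodType) (s : seq (seq R)) : 'M[R]_3 :=
  \matrix_(i, j) nth 0 (nth [::] s i) j.

Lemma round_int (x m : int) : 0 < m -> exists c, `|2 * (x - m * c)| <= m.
Proof.
(* This quotient is the floor of x/m + 1/2, an integer nearest to x/m. *)
move=> m0; exists ((2 * x + m) %/ (2 * m))%Z.
have := divz_eq (2 * x + m) (2 * m).
have : (0 <= (2 * x + m) %% (2 * m))%Z by apply: modz_ge0; lia.
have : ((2 * x + m) %% (2 * m) < 2 * m)%Z by apply: ltz_pmod; lia.
set r := modz _ _; set d := divz _ _ => rlt r0 E.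
have -> : 2 * (x - m * d) = r - m by lia.
by lia.
Qed.

(** Each coordinate is off by at most m/2, so the remainder has norm at most m^2/2; the bound is
    doubled to stay in the integers. *)
Lemma round_gauss (x : gauss int) (m : int) : 0 < m ->
  exists c, 2 * gN (x - gC m * c) <= m ^+ 2.
Proof.
move=> m0; have [c Hc] := round_int (gre x) m0; have [d Hd] := round_int (gim x) m0.
exists (Gauss c d); rewrite /gN !gE /=.
rewrite !mul0r subr0 addr0.
set u := gre x - m * c in Hc *; set w := gim x - m * d in Hd *.
have : (2 * u) ^+ 2 <= m ^+ 2 by rewrite -real_normK ?num_real // ler_sqr ?nnegrE //; lia.
have : (2 * w) ^+ 2 <= m ^+ 2 by rewrite -real_normK ?num_real // ler_sqr ?nnegrE //; lia.
by rewrite !expr2; lia.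
Qed.

(** The value of a hermitian form is real; its real part is extracted because [gauss int] carries no
    order. *)
Definition posdef n (H : 'M[gauss int]_n) :=
  forall u : 'rV_n, u != 0 -> 0 < gre ((u *m H *m u^h) 0 0).

Definition unimodular (H : 'M[gauss int]_3) := [/\ H^h = H, posdef H & \det H = 1].

Lemma gN_ge0 (x : gauss int) : 0 <= gN x.
Proof. by rewrite /gN addr_ge0 ?sqr_ge0. Qed.

Lemma gN_eq0 (R : realDomainType) (x : gauss R) : gN x = 0 -> x = 0.
Proof.
move=> /eqP; rewrite /gN paddr_eq0 ?sqr_ge0 // !sqrf_eq0 => /andP[/eqP a /eqP b].
exact: gaussP.
Qed.

Lemma pos_unit (s t : int) : 0 <= s -> 0 <= t -> s * t = 1 -> s = 1.
Proof. by case: s t => [s|//] [t|//] _ _ [] /eqP; rewrite muln_eq1 => /andP[/eqP ->]. Qed.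

Lemma unimodular_cong (H U V : 'M[gauss int]_3) : U *m V = 1%:M ->
  unimodular H -> unimodular (U *m H *m U^h).
Proof.
move=> UV [Hh Hp Hd]; split.
- by rewrite !mxstarM mxstarK Hh mulmxA.
- move=> u u0; have -> : u *m (U *m H *m U^h) *m u^h = (u *m U) *m H *m (u *m U)^h.
    by rewrite mxstarM !mulmxA.
  apply: Hp; apply: contraNneq u0 => E.
  by rewrite -(mulmx1 u) -UV mulmxA E mul0mx.
- rewrite !det_mulmx Hd mulr1 det_mxstar mul_gbar.
  (* The norm of [\det U] is a nonnegative integer with inverse [gN (\det V)], hence 1. *)
  have : gN (\det U) * gN (\det V) = 1 by rewrite -gNM -det_mulmx UV det1 (gNC 1) expr1n.
  move: (gN_ge0 (\det U)) (gN_ge0 (\det V)).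
  set s := gN (\det U); set t := gN (\det V).
  by move=> s0 t0 /(pos_unit s0 t0) ->.
Qed.

(* Reduction modulo 1 + i. *)
Definition parity (x : gauss int) : 'F_2 := (gre x + gim x)%:~R.

Fact parity_zmod : zmod_morphism parity.
Proof. by move=> x y; rewrite /parity -rmorphB /=; congr (_%:~R); rewrite !gE /=; ring. Qed.

Fact parity_monoid : monoid_morphism parity.
Proof.
split=> [|x y]; first by rewrite /parity !gE addr0.
rewrite /parity -rmorphM /= !gE /=; set a := gre x; set b := gim x; set c := gre y; set d := gim y.
have -> : (a + b) * (c + d) = (a * c - b * d + (a * d + b * c)) + 2 * (b * d) :> int by ring.
by rewrite [RHS]rmorphD /= [(2 * _)%:~R]rmorphM /= (_ : 2%:~R = 0) ?mul0r ?addr0 //; apply/eqP.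
Qed.
HB.instance Definition _ := GRing.isZmodMorphism.Build (gauss int) 'F_2 parity parity_zmod.
HB.instance Definition _ := GRing.isMonoidMorphism.Build (gauss int) 'F_2 parity parity_monoid.

Lemma F2_sqr (a : 'F_2) : a ^+ 2 = a.
Proof. by case: a => [[|[|a]] lta] //; apply/eqP. Qed.

(** Squaring is the identity on ['F_2], so divisibility by 1 + i can be read off the norm. *)
Lemma parity_gN x : parity x = (gN x)%:~R.
Proof. by rewrite /parity /gN !rmorphD /= !rmorphXn /= !F2_sqr. Qed.

Section Reduction.
Implicit Types H : 'M[gauss int]_3.

Definition h00 H := gre (H o0 o0).
(* mu, nu and m12 are the entries of h00 times the form induced by H on the orthogonal
   complement of the first basis vector. *)
Definition mu H := h00 H * gre (H o1 o1) - gN (H o0 o1).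
Definition nu H := h00 H * gre (H o2 o2) - gN (H o0 o2).
Definition m12 H := gC (h00 H) * H o1 o2 - gbar (H o0 o1) * H o0 o2.

Lemma herm H i j : H^h = H -> H j i = gbar (H i j).
Proof. by move=> E; rewrite -[in LHS]E mxstarE. Qed.

Lemma herm_diag H i : H^h = H -> gim (H i i) = 0.
Proof. by move=> /(herm i i) /(congr1 (@gim _)); rewrite gim_bar /=; lia. Qed.

Lemma mk3_neq0 (s : seq (gauss int)) (i : 'I_3) : s`_i != 0 ->
  (\row_(j < 3) s`_j) != 0.
Proof. by apply: contraNneq => /rowP/(_ i); rewrite !mxE => ->. Qed.

Lemma h00_gt0 H : unimodular H -> 0 < h00 H.
Proof.
case=> _ Hp _; have := Hp (delta_mx 0 o0).
have -> : (delta_mx 0 o0 : 'rV[gauss int]_3) != 0.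
  by apply/eqP => /rowP/(_ o0)/eqP; rewrite !mxE eqxx /= oner_eq0.
move=> /(_ isT); rewrite -rowE.
by rewrite mxE sum3 !mxE /= /h00; lia.
Qed.

Lemma mu_gt0 H : unimodular H -> 0 < mu H.
Proof.
move=> good; have m0 := h00_gt0 good; case: good => Hh Hp _.
(* This vector is orthogonal to the first basis vector, and the form takes the value [h00 H * mu H]
   on it. *)
have := Hp (\row_j [:: - gbar (H o0 o1); gC (h00 H); 0]`_j).
rewrite (@mk3_neq0 _ o1); last first.
  by apply/eqP => /(congr1 (@gre _)) /=; lia.
move=> /(_ isT); rewrite mxE sum3 !mxE !sum3 !mxE /=.
rewrite (herm o0 o1 Hh) (herm o0 o2 Hh) (herm o1 o2 Hh) /= (herm_diag o0 Hh) (herm_diag o1 Hh).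
rewrite -/(h00 H) => E; suff : 0 < h00 H * mu H by rewrite pmulr_rgt0.
by move: E; congr (0 < _); rewrite /mu /gN; ring.
Qed.

(** The form on the orthogonal complement has determinant det H / h00; scaling this 2x2 form by
    [h00] multiplies that by h00^2, and det H = 1. *)
Lemma mu_nu H : unimodular H -> mu H * nu H - gN (m12 H) = h00 H.
Proof.
case=> Hh _ /(congr1 (@gre _)); rewrite det3 /=.
rewrite (herm o0 o1 Hh) (herm o0 o2 Hh) (herm o1 o2 Hh) /=.
rewrite (herm_diag o0 Hh) (herm_diag o1 Hh) (herm_diag o2 Hh).
rewrite -/(h00 H) => E; rewrite -[RHS]mulr1 -[in RHS]E /mu /nu /m12 /gN /= -/(h00 H); ring.
Qed.

Definition elim3 (a b c : gauss int) : 'M_3 :=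
  mk3 [:: [:: 1; 0; 0]; [:: - a; 1; 0]; [:: - b; - c; 1]].
Definition elim3V (a b c : gauss int) : 'M_3 :=
  mk3 [:: [:: 1; 0; 0]; [:: a; 1; 0]; [:: b + c * a; c; 1]].

Lemma elim3K a b c : elim3 a b c *m elim3V a b c = 1%:M.
Proof.
apply/matrixP; apply: forall3; apply: forall3; rewrite !mxE sum3 !mxE /=; ring.
Qed.

Definition swap01 : 'M[gauss int]_3 := mk3 [:: [:: 0; 1; 0]; [:: 1; 0; 0]; [:: 0; 0; 1]].
Definition swap02 : 'M[gauss int]_3 := mk3 [:: [:: 0; 0; 1]; [:: 0; 1; 0]; [:: 1; 0; 0]].
Definition swap12 : 'M[gauss int]_3 := mk3 [:: [:: 1; 0; 0]; [:: 0; 0; 1]; [:: 0; 1; 0]].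

Lemma swapK : [/\ swap01 *m swap01 = 1%:M, swap02 *m swap02 = 1%:M & swap12 *m swap12 = 1%:M].
Proof.
by split; apply/matrixP; apply: forall3; apply: forall3; rewrite !mxE sum3 !mxE /=; ring.
Qed.

Lemma conj3E (U H : 'M[gauss int]_3) i j : (U *m H *m U^h) i j =
  (U i o0 * H o0 o0 + U i o1 * H o1 o0 + U i o2 * H o2 o0) * gbar (U j o0) +
  (U i o0 * H o0 o1 + U i o1 * H o1 o1 + U i o2 * H o2 o1) * gbar (U j o1) +
  (U i o0 * H o0 o2 + U i o1 * H o1 o2 + U i o2 * H o2 o2) * gbar (U j o2).
Proof. by rewrite mxE sum3 !mxstarE !mxE !sum3. Qed.

(** Size reduction by a unitriangular change of basis, which preserves [h00] and [mu]. The
    multiplier c shrinks [m12] modulo [mu] and is chosen first because it also alters the entry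
    (0,2); a and b then shrink the first row modulo [h00] without affecting [m12]. *)
Lemma reduce H : unimodular H -> exists U V,
  let H' := U *m H *m U^h in
  [/\ U *m V = 1%:M, h00 H' = h00 H, mu H' = mu H, 2 * gN (m12 H') <= mu H ^+ 2 &
   2 * gN (H' o0 o1) <= h00 H ^+ 2 /\ 2 * gN (H' o0 o2) <= h00 H ^+ 2].
Proof.
move=> good; have m0 := h00_gt0 good; have mu0 := mu_gt0 good; case: (good) => Hh _ _.
have [c Hc] := round_gauss (m12 H) mu0.
have [a Ha] := round_gauss (H o0 o1) m0.
have [b Hb] := round_gauss (H o0 o2 - c * H o0 o1) m0.
pose U := elim3 (gbar a) (gbar b) (gbar c); exists U, (elim3V (gbar a) (gbar b) (gbar c)).
have E00 : H o0 o0 = gC (h00 H) by apply: gaussP => //=; exact: herm_diag.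
have E01 : (U *m H *m U^h) o0 o1 = H o0 o1 - gC (h00 H) * a.
  by rewrite conj3E !mxE /= E00; apply: gaussP; rewrite /=; ring.
have E02 : (U *m H *m U^h) o0 o2 = H o0 o2 - c * H o0 o1 - gC (h00 H) * b.
  by rewrite conj3E !mxE /= E00; apply: gaussP; rewrite /=; ring.
have Eh : h00 (U *m H *m U^h) = h00 H.
  by rewrite /h00 conj3E !mxE /=; ring.
split.
- exact: elim3K.
- exact: Eh.
- rewrite /mu Eh E01 conj3E !mxE /= /gN (herm o0 o1 Hh) E00 /=.
  rewrite (herm_diag o1 Hh); ring.
- congr (_ <= _): Hc; congr (2 * gN _).
  rewrite /m12 Eh E01 E02 conj3E !mxE /= (herm o0 o1 Hh) E00.
  apply: gaussP; rewrite /mu /= /gN /= (herm_diag o1 Hh); ring.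
- by rewrite E01 E02; split.
Qed.

(** Put m = h00 and u = mu. From m H11 - N(H01) = u and u nu - N(m12) = m, the reduction
    inequalities give m^2 <= 2u and u^2 <= 2m, so m = u = 1 or m = u = 2. The first case forces the
    identity; the second contradicts det H = 1 modulo 1 + i. *)
Lemma reduced_id H : unimodular H -> 2 * gN (m12 H) <= mu H ^+ 2 ->
  2 * gN (H o0 o1) <= h00 H ^+ 2 -> 2 * gN (H o0 o2) <= h00 H ^+ 2 ->
  mu H <= nu H -> h00 H <= gre (H o1 o1) -> h00 H <= gre (H o2 o2) -> H = 1%:M.
Proof.
move=> good; have m0 := h00_gt0 good; have mu0 := mu_gt0 good; have := mu_nu good.
case: (good) => Hh _ Hd.
have E00 : H o0 o0 = gC (h00 H) by apply: gaussP => //=; exact: herm_diag.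
have := erefl (mu H); rewrite {1}/mu; have := erefl (nu H); rewrite {1}/nu.
have := gN_ge0 (m12 H); have := gN_ge0 (H o0 o1); have := gN_ge0 (H o0 o2).
rewrite !expr2; set s := gN (m12 H); set a := gN (H o0 o1); set b := gN (H o0 o2).
set m := h00 H; set u := mu H; set w := nu H.
set h := gre (H o1 o1); set k := gre (H o2 o2).
move=> b0 a0 s0 Ew Eu Em Hs Ha Hb uw mh mk.
have m1 : 1 <= m by rewrite -gtz0_ge1.
have u1 : 1 <= u by rewrite -gtz0_ge1.
have mm : m * m <= 2 * u.
  by have := ler_wpM2l (ltW m0) mh; lia.
have uu : u * u <= 2 * m.
  by have := ler_wpM2l (ltW mu0) uw; lia.
have [m2 u2] : m <= 2 /\ u <= 2.
  case: (leP u m) => um.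
    have : m * m <= 2 * m by lia.
    by rewrite ler_pM2r //; lia.
  have : u * u <= 2 * u by lia.
  by rewrite ler_pM2r //; lia.
have [m_eq|m_eq] : m = 1 \/ m = 2 by lia.
  have u_eq : u = 1.
    have [//|u_eq] : u = 1 \/ u = 2 by lia.
    by move: uu; rewrite u_eq m_eq.
  rewrite m_eq u_eq in Ew Eu Em Hs Ha Hb.
  have a_eq : a = 0 by lia.
  have b_eq : b = 0 by lia.
  have s_eq : s = 0 by lia.
  have H01 := gN_eq0 a_eq; have H02 := gN_eq0 b_eq.
  have H12 : H o1 o2 = 0.
    by have := gN_eq0 s_eq; rewrite /m12 H01 -/m m_eq rmorph0 mul0r subr0 rmorph1 mul1r.
  have H11 : H o1 o1 = 1 by apply: gaussP; rewrite /= ?(herm_diag o1 Hh) //; lia.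
  have H22 : H o2 o2 = 1 by apply: gaussP; rewrite /= ?(herm_diag o2 Hh) //; lia.
  apply/matrixP; apply: forall3; apply: forall3; rewrite !mxE /=.
  - by rewrite E00 -/m m_eq.
  - by rewrite H01.
  - by rewrite H02.
  - by rewrite (herm o0 o1 Hh) H01 rmorph0.
  - by rewrite H11.
  - by rewrite H12.
  - by rewrite (herm o0 o2 Hh) H02 rmorph0.
  - by rewrite (herm o1 o2 Hh) H12 rmorph0.
  - by rewrite H22.
(* When m = u = 2 the inequalities are tight and H01, H02 have norm 2. The whole first row is then
   divisible by 1 + i, and so is the determinant. *)
have u_eq : u = 2.
  have [u_eq|//] : u = 1 \/ u = 2 by lia.
  by move: mm; rewrite u_eq m_eq.
rewrite m_eq u_eq in Ew Eu Em Hs Ha Hb mh mk.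
have a_eq : a = 2 by lia.
have b_eq : b = 2 by lia.
have two : (2%:~R : 'F_2) = 0 by apply/eqP.
move/(congr1 parity): Hd; rewrite det3 rmorph1 !rmorphD /= rmorphN /= !rmorphM /=.
rewrite [parity (H o0 o0)]parity_gN E00 gNC -/m m_eq.
rewrite [parity (H o0 o1)]parity_gN -/a a_eq [parity (H o0 o2)]parity_gN -/b b_eq.
rewrite rmorphXn /= two expr2 !mul0r subr0 addr0 => /esym/eqP.
by rewrite oner_eq0.
Qed.

Lemma h00_swap01 H : h00 (swap01 *m H *m swap01^h) = gre (H o1 o1).
Proof. by rewrite /h00 conj3E !mxE /=; ring. Qed.
Lemma h00_swap02 H : h00 (swap02 *m H *m swap02^h) = gre (H o2 o2).
Proof. by rewrite /h00 conj3E !mxE /=; ring. Qed.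
Lemma h00_swap12 H : h00 (swap12 *m H *m swap12^h) = h00 H.
Proof. by rewrite /h00 conj3E !mxE /=; ring. Qed.
Lemma mu_swap12 H : mu (swap12 *m H *m swap12^h) = nu H.
Proof.
rewrite /mu /nu h00_swap12; congr (_ * _ - gN _).
  by rewrite conj3E !mxE /=; ring.
by rewrite conj3E !mxE /=; apply: gaussP; rewrite /=; ring.
Qed.

(** Descent on [h00] and, for bounded [h00], on [mu]. After size reduction, either a smaller
    diagonal entry is swapped to the front, or a smaller [nu] takes the place of [mu], or
    [reduced_id] applies. *)
Lemma unimodular_standard H : unimodular H -> exists U : 'M_3, U *m H *m U^h = 1%:M.
Proof.
have [n] := ubnP (absz (h00 H)); elim: n H => // n IHn H.
have [k] := ubnP (absz (mu H)); elim: k H => // k IHk H.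
rewrite !ltnS => Hk Hn good.
have [U [V [UV e00 emu red12 [red01 red02]]]] := reduce good.
have good' := unimodular_cong UV good.
have [H' EH'] : exists H', H' = U *m H *m U^h by exists (U *m H *m U^h).
rewrite -EH' in good' e00 emu red12 red01 red02.
have back (W : 'M_3) : (exists X : 'M_3, X *m (W *m H' *m W^h) *m X^h = 1%:M) ->
    exists X : 'M_3, X *m H *m X^h = 1%:M.
  by case=> X E; exists (X *m W *m U); rewrite -E EH' !mxstarM !mulmxA.
have [K01 K02 K12] := swapK.
have m0 := h00_gt0 good'; have mu0 := mu_gt0 good'.
rewrite -e00 -emu in red12 red01 red02 Hk Hn.
have [lt1|le1] := ltP (gre (H' o1 o1)) (h00 H').
  apply: (back swap01); have good1 := unimodular_cong K01 good'.
  by apply: IHn => //; have := h00_gt0 good1; move: Hn lt1 m0; rewrite h00_swap01; lia.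
have [lt2|le2] := ltP (gre (H' o2 o2)) (h00 H').
  apply: (back swap02); have good1 := unimodular_cong K02 good'.
  by apply: IHn => //; have := h00_gt0 good1; move: Hn lt2 m0; rewrite h00_swap02; lia.
have [lt3|le3] := ltP (nu H') (mu H').
  apply: (back swap12); have good1 := unimodular_cong K12 good'.
  apply: IHk => //; last by rewrite h00_swap12.
  by have := mu_gt0 good1; move: Hk lt3 mu0; rewrite mu_swap12; lia.
by exists U; rewrite -EH'; apply: reduced_id.
Qed.
End Reduction.

(** * Selfdual Gaussian lattices *)

Lemma gC_mul_eq0 (R : idomainType) (q : R) (x : gauss R) : q != 0 -> gC q * x = 0 -> x = 0.
Proof.
move=> q0 E; apply: gaussP.
  by move/(congr1 (@gre _)): E => /eqP; rewrite /= mul0r subr0 mulf_eq0 (negPf q0) => /eqP.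
by move/(congr1 (@gim _)): E => /eqP; rewrite /= mul0r addr0 mulf_eq0 (negPf q0) => /eqP.
Qed.

(** Since [gauss R] may have zero divisors, the adjugate is used: det A annihilates B A - q, hence
    so does det A det B = q^n, and a nonzero scalar of [R] cancels coordinatewise. *)
Lemma scal_mulmxC (R : idomainType) n (q : R) (A B : 'M[gauss R]_n) : q != 0 ->
  A *m B = (gC q)%:M -> B *m A = (gC q)%:M.
Proof.
move=> q0 AB; pose X := B *m A - (gC q)%:M.
have X0 : \det A *: X = 0.
  have E : \det A *: B = gC q *: \adj A.
    by rewrite -mul_scalar_mx -mul_adj_mx -mulmxA AB mul_mx_scalar.
  rewrite scalerBr scalemxAl E -scalemxAl mul_adj_mx !scale_scalar_mx mulrC subrr //.
have detAB : \det A * \det B = gC (q ^+ n) by rewrite -det_mulmx AB det_scalar -rmorphXn.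
apply/eqP; rewrite -subr_eq0 -/X; apply/eqP/matrixP => i j; rewrite [RHS]mxE.
apply: (@gC_mul_eq0 _ (q ^+ n)); first exact: expf_neq0.
have /matrixP/(_ i j) := congr1 ( *:%R (\det B)) X0.
by rewrite scalerA mulrC detAB scaler0 !mxE.
Qed.

Lemma min_elt (T : Type) (P : T -> Prop) (f : T -> nat) :
  (exists x, P x) -> exists x, P x /\ forall y, P y -> (f x <= f y)%N.
Proof.
case=> x; have [n] := ubnP (f x); elim: n x => // n IHn x; rewrite ltnS => fx Px.
case: (classic (exists y, P y /\ (f y < f x)%N)) => [[y [Py fy]]|none].
  by apply: (IHn y) => //; apply: leq_trans fx.
exists x; split=> // y Py; rewrite leqNgt; apply/negP => fy.
by apply: none; exists y.
Qed.

(** Rounding x/a = x conj(a)/N(a) to a nearby Gaussian integer leaves a remainder of norm at most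
    N(a)/2. *)
Lemma gauss_euclid (a x : gauss int) : a != 0 -> exists c, gN (x - c * a) < gN a.
Proof.
move=> a0; have Na : 0 < gN a.
  by rewrite lt_def gN_ge0 andbT; apply: contraNneq a0 => /gN_eq0 ->.
have [c Hc] := round_gauss (x * gbar a) Na; exists c.
have E : x * gbar a - gC (gN a) * c = gbar a * (x - c * a) by rewrite -mul_gbar; ring.
have := gN_ge0 (x - c * a); move: Hc; rewrite E gNM gN_bar expr2 mulrCA.
by rewrite ler_pM2l //; lia.
Qed.

Lemma fin_choice (I : finType) (T : Type) (P : I -> T -> Prop) :
  (forall i, exists x, P i x) -> exists f : I -> T, forall i, P i (f i).
Proof. by move=> H; case: (fin_all_exists H) => f Hf; exists f. Qed.

(** * Triangular bases of sublattices of Z[i]^3 *)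

Section Lattice.
Variable L : 'cV[gauss int]_3 -> Prop.
Hypothesis LD : forall x y, L x -> L y -> L (x + y).
Hypothesis LZ : forall c x, L x -> L (c *: x).

Let Lj (j : nat) x := L x /\ forall i : 'I_3, (i < j)%N -> x i 0 = 0.

(** Take b in [Lj j] whose coordinate j is nonzero of least norm; by Euclidean division a multiple
    of b clears that coordinate of any other member. *)
Lemma lattice_step (j : 'I_3) : (exists x, Lj j x /\ x j 0 != 0) ->
  exists b, L b /\ forall x, Lj j x -> exists c, Lj j.+1 (x - c *: b).
Proof.
move=> /(@min_elt _ _ (fun x : 'cV[gauss int]_3 => absz (gN (x j 0)))) [b [[[Lb bi] bj] bmin]].
exists b; split=> // x [Lx xi].
have [c Hc] := gauss_euclid (x j 0) bj; exists c.
have Ly : Lj j (x - c *: b).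
  split; first by rewrite -scaleNr; apply: LD => //; apply: LZ.
  by move=> i ij; rewrite !mxE xi // bi // mulr0 subr0.
split; first by case: Ly.
move=> i; rewrite ltnS leq_eqVlt => /orP[/eqP/val_inj -> |]; last by case: Ly => _; apply.
apply/eqP; apply: contraT => y0; have := bmin _ (conj Ly y0).
rewrite /= !mxE; move: Hc (gN_ge0 (b j 0)) (gN_ge0 (x j 0 - c * b j 0)).
by set s := gN (b j 0); set t := gN (x j 0 - c * b j 0); lia.
Qed.

(** The vectors q e_j guarantee a nonzero pivot in each coordinate. Three elimination steps then
    leave a vector with all coordinates zero. *)
Lemma lattice_basis (q : int) : 0 < q -> (forall j, L (gC q *: delta_mx j 0)) ->
  exists B : 'M_3, forall x, L x <-> exists z, x = B *m z.
Proof.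
move=> q0 Lq.
have wit (j : 'I_3) : exists x, Lj j x /\ x j 0 != 0.
  exists (gC q *: delta_mx j 0); split; first (split; first exact: Lq) => i ij.
    rewrite !mxE (_ : i == j = false) ?mulr0 //.
    by apply/eqP => E; rewrite E ltnn in ij.
  by rewrite !mxE !eqxx mulr1; apply/eqP => /(congr1 (@gre _)) /=; lia.
have [b0 [Lb0 Hb0]] := lattice_step (wit o0).
have [b1 [Lb1 Hb1]] := lattice_step (wit o1).
have [b2 [Lb2 Hb2]] := lattice_step (wit o2).
pose b (j : 'I_3) := nth 0 [:: b0; b1; b2] j.
pose B : 'M[gauss int]_3 := \matrix_(i, j) b j i 0.
have BE (z : 'cV_3) : B *m z = z o0 0 *: b0 + z o1 0 *: b1 + z o2 0 *: b2.
  by apply/matrixP => i j; rewrite !ord1 !mxE sum3 !mxE /b /=; congr (_ + _ + _); rewrite mulrC.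
exists B => x; split=> [Lx|[z ->]]; last first.
  by rewrite BE; do 2![apply: LD; last exact: LZ]; apply: LZ.
have [|c0 /Hb1 [c1 /Hb2 [c2 [_ E]]]] := Hb0 x; first by split.
exists (\col_j [:: c0; c1; c2]`_j); rewrite BE !mxE /=.
apply/eqP; rewrite -subr_eq0; apply/eqP/matrixP => i j; rewrite ord1.
by rewrite !opprD !addrA [RHS]mxE; apply: E.
Qed.
End Lattice.

(** * Divisibility by a rational integer and the hermitian pairing *)

Definition dvg (q : int) (x : gauss int) := exists y, x = gC q * y.

Lemma dvgD q x y : dvg q x -> dvg q y -> dvg q (x + y).
Proof. by move=> [a ->] [b ->]; exists (a + b); rewrite mulrDr. Qed.
Lemma dvgM q x y : dvg q x -> dvg q (x * y).
Proof. by move=> [a ->]; exists (a * y); rewrite mulrA. Qed.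
Lemma dvgMl q x y : dvg q x -> dvg q (y * x).
Proof. by rewrite mulrC; apply: dvgM. Qed.
Lemma dvg_bar q x : dvg q x -> dvg q (gbar x).
Proof. by move=> [a ->]; exists (gbar a); rewrite rmorphM /= gbarC. Qed.
Definition gdot n (y x : 'cV[gauss int]_n) := (y^h *m x) 0 0.

Lemma gdot_sym n (x y : 'cV_n) : gdot y x = gbar (gdot x y).
Proof. by rewrite /gdot -mxstarE mxstarM mxstarK. Qed.
Lemma gdotD n (y a b : 'cV_n) : gdot y (a + b) = gdot y a + gdot y b.
Proof. by rewrite /gdot mulmxDr mxE. Qed.
Lemma gdotZ n (y a : 'cV_n) c : gdot y (c *: a) = c * gdot y a.
Proof. by rewrite /gdot -scalemxAr mxE. Qed.
Lemma gdot_mulmx n (A B : 'M_n) (i j : 'I_n) :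
  gdot (A *m delta_mx i 0) (B *m delta_mx j 0) = (A^h *m B) i j.
Proof.
rewrite /gdot -!colE !mxE; apply: eq_bigr => k _; rewrite !mxE //.
Qed.

Lemma factor_columns (R : comNzRingType) n (A B : 'M[R]_n) :
  (forall j, exists z : 'cV_n, A *m delta_mx j 0 = B *m z) -> exists C : 'M_n, A = B *m C.
Proof.
move=> /fin_choice[c Hc]; exists (\matrix_(i, j) c j i 0); apply/matrixP => i j.
have /matrixP/(_ i 0) := Hc j; rewrite -colE mxE => ->.
by rewrite !mxE; apply: eq_bigr => k _; rewrite !mxE.
Qed.

(** Selfduality makes [L] a lattice containing q Z[i]^3, with a basis [B]. It also makes the Gram
    matrix B^h B equal to q G with [G] unimodular, so a matrix [U] bringing [G] to the identity
    turns [B] into A = B U^h. *)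
Lemma selfdual_lattice (q : int) (L : 'cV[gauss int]_3 -> Prop) : 0 < q ->
  (forall x, L x <-> forall y, L y -> dvg q (gdot y x)) ->
  exists A : 'M_3, A *m A^h = (gC q)%:M /\ forall x, L x <-> exists z, x = A *m z.
Proof.
move=> q0 dual.
have qn0 : q != 0 by lia.
have LD x y : L x -> L y -> L (x + y).
  move=> /dual Lx /dual Ly; apply/dual => z Lz; rewrite gdotD.
  by apply: dvgD; [apply: Lx|apply: Ly].
have LZ c x : L x -> L (c *: x).
  by move=> /dual Lx; apply/dual => z Lz; rewrite gdotZ; apply: dvgMl; apply: Lx.
have Lq x : L (gC q *: x).
  by apply/dual => y _; rewrite gdotZ; apply: dvgM; exists 1; rewrite mulr1.
have [B HB] := lattice_basis LD LZ q0 (fun j => Lq _).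
have LB z : L (B *m z) by apply/HB; exists z.
have [C HC] : exists C : 'M_3, B *m C = (gC q)%:M.
  have [|C HC] := @factor_columns _ _ (gC q)%:M B; last by exists C.
  by move=> j; rewrite mul_scalar_mx; apply/HB.
have HC' := scal_mulmxC qn0 HC.
have [G HG] : exists G : 'M_3, B^h *m B = gC q *: G.
  have /fin_choice[g Hg] : forall i : 'I_3, exists g : 'I_3 -> gauss int, forall j,
      (B^h *m B) i j = gC q * g j.
    move=> i; apply: (@fin_choice _ _ (fun j x => (B^h *m B) i j = gC q * x)) => j.
    by rewrite -gdot_mulmx; apply: (dual _).1; apply: LB.
  by exists (\matrix_(i, j) g i j); apply/matrixP => i j; rewrite Hg !mxE.
(* Columns of [C^h] pair with B z to multiples of q, because B^h C^h = (C B)^h = q, so they lie in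
   [L]. The resulting [D] is the inverse of [G]. *)
have [D HD] : exists D, C^h = B *m D.
  apply: factor_columns => j; apply/HB/dual => y /HB [z ->].
  rewrite /gdot mxstarM !mulmxA -[_ *m B^h *m C^h]mulmxA.
  rewrite -mxstarM HC' mxstar_scalar gbarC mul_mx_scalar -scalemxAl mxE.
  by apply: dvgM; exists 1; rewrite mulr1.
have cancel (X Y : 'M[gauss int]_3) : gC q *: X = gC q *: Y -> X = Y.
  move=> E; apply/matrixP => i j; apply/eqP; rewrite -subr_eq0; apply/eqP.
  apply: (gC_mul_eq0 qn0); rewrite mulrBr; apply/eqP; rewrite subr_eq0.
  by have /matrixP/(_ i j) := E; rewrite !mxE => ->.
have GD : G *m D = 1%:M.
  apply: cancel; rewrite scalemxAl -HG -mulmxA -HD -mxstarM HC' mxstar_scalar gbarC.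
  by rewrite scale_scalar_mx mulr1.
have Gh : G^h = G.
  by apply: cancel; rewrite -HG -[gC q]gbarC -mxstarZ -HG mxstarM mxstarK.
have uG : unimodular G.
  split=> //.
    move=> u u0; pose w := u *m B^h.
    have E : q * gre ((u *m G *m u^h) 0 0) = \sum_i gN (w 0 i).
      have -> : q * gre ((u *m G *m u^h) 0 0) = gre ((gC q *: (u *m G *m u^h)) 0 0).
        by rewrite [in RHS]mxE greM greC gimC mul0r subr0.
      have -> : gC q *: (u *m G *m u^h) = w *m w^h.
        by rewrite scalemxAl scalemxAr -HG /w mxstarM mxstarK !mulmxA.
      rewrite mxE raddf_sum; apply: eq_bigr => i _.
      by rewrite mxstarE mul_gbar.
    rewrite -(pmulr_rgt0 _ q0) E lt_def sumr_ge0 ?andbT => [|i _]; last exact: gN_ge0.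
    apply: contraNneq u0 => /eqP; rewrite psumr_eq0 => [|i _]; last exact: gN_ge0.
    move=> /allP w0; have w_eq : w = 0.
      apply/rowP => i; rewrite [RHS]mxE; apply: gN_eq0; apply/eqP.
      exact: (implyP (w0 i (mem_index_enum _))).
    have : gC q *: u = 0.
      by rewrite -mul_mx_scalar -[gC q]gbarC -mxstar_scalar -HC' mxstarM mulmxA -/w w_eq mul0mx.
    move=> E0; apply/eqP/rowP => i; rewrite [RHS]mxE; apply: (gC_mul_eq0 qn0).
    by have /rowP/(_ i) := E0; rewrite !mxE.
  (* The determinant of [G] has norm 1 because [G] is invertible; by this equation it is also real
     and nonnegative, hence equal to 1. *)
  have dq : gC (gN (\det B)) = gC (q ^+ 3) * \det G.
    by rewrite -mul_gbar mulrC -det_mxstar -det_mulmx HG detZ rmorphXn.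
  have dN : gN (\det G) = 1.
    apply: (@pos_unit _ (gN (\det D))); [exact: gN_ge0|exact: gN_ge0|].
    by rewrite -gNM -det_mulmx GD det1 (gNC 1) expr1n.
  have im0 : gim (\det G) = 0.
    move/(congr1 (@gim _)): dq => /esym/eqP; rewrite gimM gimC greC mul0r addr0.
    by rewrite mulf_eq0 expf_eq0 /= (negPf qn0) => /eqP.
  have re0 : 0 <= gre (\det G).
    move/(congr1 (@gre _)): dq; rewrite greM gimC !greC mul0r subr0 => E.
    by rewrite -(pmulr_rge0 _ (exprn_gt0 3 q0)) -E gN_ge0.
  apply: gaussP => //; move: dN; rewrite /gN im0 expr0n addr0 => /eqP.
  by rewrite sqrp_eq1 // => /eqP.
have [U HU] := unimodular_standard uG.
pose A := B *m U^h; exists A; split.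
  apply: scal_mulmxC => //; rewrite /A mxstarM mxstarK.
  by rewrite mulmxA -[U *m _ *m B]mulmxA HG -scalemxAr -scalemxAl HU scale_scalar_mx mulr1.
(* Since [U^h] is invertible, [A] and [B] span the same lattice. *)
have UV : U^h *m (U *m G) = 1%:M by apply: mulmx1C.
move=> x; rewrite HB; split=> -[z ->].
  by exists (U *m G *m z); rewrite /A -!mulmxA [U^h *m _]mulmxA [U^h *m _ *m _]mulmxA -[_ *m U *m G]mulmxA UV mul1mx.
by exists (U^h *m z); rewrite /A -mulmxA.
Qed.

(** * The local picture *)

Definition GUM (R : comNzRingType) (S : R -> Prop) (g : 'M[gauss R]_3) :=
  (forall i j, S (gre (g i j)) /\ S (gim (g i j))) /\
  exists l, S_unit S l /\ g *m g^h = (gC l)%:M.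

(** Matrix form of [vertex_eq]. The scalar c comes with its inverse d, as K[i] need not be a
    field. *)
Definition same_vertex (K : fieldType) (v : K -> int) (g h : 'M[gauss K]_3) :=
  exists c d k, c * d = 1 /\ GUM (Defs.Zp v) k /\ h = c *: (g *m k).

Definition gint (K : comNzRingType) : gauss int -> gauss K := gmapc (intmul 1).
HB.instance Definition _ (K : comNzRingType) := GRing.RMorphism.on (@gint K).

Lemma gint_bar (K : comNzRingType) (x : gauss int) : gint K (gbar x) = gbar (gint K x).
Proof. exact: gmapc_bar. Qed.
Lemma gintC (K : comNzRingType) (z : int) : gint K (gC z) = gC z%:~R.
Proof. exact: gmapcC. Qed.
Lemma map_gint_star (K : comNzRingType) m n (A : 'M_(m, n)) :
  map_mx (@gint K) A^h = (map_mx (@gint K) A)^h.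
Proof. exact: map_mxstar. Qed.

(** * The valuation of Q_p and approximation of p-adic integers by integers *)

Section Local.
Variables (p : nat) (Hp : prime p) (K : fieldType) (iota : {rmorphism rat -> K}) (v : K -> int).
Hypothesis HK : is_Qp p iota v.

Lemma val_mul x y : x != 0 -> y != 0 -> v (x * y) = v x + v y.
Proof. by case: HK => H _ _ _ _; apply: H. Qed.

Lemma val_geD x y n : val_ge v x n -> val_ge v y n -> val_ge v (x + y) n.
Proof. by case: HK => _ H _ _ _; apply: H. Qed.


Lemma val_geM x y m n : val_ge v x m -> val_ge v y n -> val_ge v (x * y) (m + n).
Proof.
have [-> _ _|x0] := eqVneq x 0; first by left; rewrite mul0r.
have [-> _ _|y0] := eqVneq y 0; first by left; rewrite mulr0.
case=> [E|xm]; first by rewrite E eqxx in x0.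
case=> [E|yn]; first by rewrite E eqxx in y0.
by right; rewrite val_mul // lerD.
Qed.

Lemma val_geMl x y n : val_ge v x 0 -> val_ge v y n -> val_ge v (x * y) n.
Proof. by rewrite -[in X in _ -> _ -> X](add0r n); apply: val_geM. Qed.

Lemma val_one : v 1 = 0.
Proof. by have := @val_mul 1 1 (oner_neq0 K) (oner_neq0 K); rewrite mulr1; lia. Qed.

Lemma val_ge_one : val_ge v 1 0.
Proof. by right; rewrite val_one. Qed.

Lemma val_opp1 : v (- 1) = 0.
Proof.
have n0 : (- 1 : K) != 0 by rewrite oppr_eq0 oner_neq0.
by have := val_mul n0 n0; rewrite mulrNN mulr1 val_one; lia.
Qed.

Lemma val_geN x n : val_ge v x n -> val_ge v (- x) n.
Proof.
by move=> xn; rewrite -mulN1r -[n]add0r; apply: val_geM => //; right; rewrite val_opp1.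
Qed.

Lemma val_geW x m n : n <= m -> val_ge v x m -> val_ge v x n.
Proof. by move=> nm [->|xm]; [left | right; apply: le_trans xm]. Qed.

Lemma val_inv x : x != 0 -> v x^-1 = - v x.
Proof.
move=> x0; have x0' : x^-1 != 0 by rewrite invr_eq0.
by have := val_mul x0 x0'; rewrite mulfV // val_one; lia.
Qed.

Lemma val_ge_int (z : int) : val_ge v z%:~R 0.
Proof.
have nat_ge (n : nat) : val_ge v n%:R 0.
  elim: n => [|n IHn]; first by left.
  by rewrite mulrS; apply: val_geD => //; apply: val_ge_one.
case: z => n; first exact: nat_ge.
by rewrite NegzE mulrNz; apply: val_geN; apply: nat_ge.
Qed.

Lemma pK_neq0 : (p%:R : K) != 0.
Proof.
by rewrite -(rmorph_nat iota) fmorph_eq0 pnatr_eq0 -lt0n prime_gt0.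
Qed.

Lemma val_p : v p%:R = 1.
Proof. by case: HK => _ _ H _ _; rewrite -(rmorph_nat iota). Qed.

Lemma val_pX k : v (p%:R ^+ k) = k%:Z.
Proof.
elim: k => [|k IHk]; first by rewrite expr0 val_one.
by rewrite exprS val_mul ?expf_neq0 ?pK_neq0 // val_p IHk; lia.
Qed.

Lemma val_ge_pX k : val_ge v (p%:R ^+ k) k%:Z.
Proof. by right; rewrite val_pX. Qed.

Lemma not_val_ge1 : ~ val_ge v 1 1.
Proof. by case=> [/eqP|]; rewrite ?oner_eq0 // val_one. Qed.

(** In a Bezout relation a p + b z = 1, a positive valuation of z would make the valuation of 1
    positive. *)
Lemma val_int_coprime (z : int) : coprimez p z -> z%:~R != 0 :> K /\ v z%:~R = 0.
Proof.
move=> cop; have [[a b] /= E] := coprimezP _ _ cop.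
have E' : a%:~R * p%:R + b%:~R * z%:~R = 1 :> K.
  by rewrite -[p%:R]/(p%:Z%:~R) -!rmorphM -rmorphD /= E.
have bad : ~ val_ge v (z%:~R : K) 1.
  move=> z1; apply: not_val_ge1; rewrite -E'; apply: val_geD; apply: val_geMl => //; try exact: val_ge_int.
  by right; rewrite val_p.
have z0 : z%:~R != 0 :> K by apply/eqP => E0; apply: bad; left.
split=> //; have [E0|] := val_ge_int z; first by rewrite E0 eqxx in z0.
by have : ~ (1 <= v z%:~R) by [move=> ?; apply: bad; right]; lia.
Qed.

Lemma val_ge_dvd (z : int) (e : nat) : val_ge v z%:~R e%:Z -> ((p ^ e)%N %| z)%Z.
Proof.
elim: e => [|e IHe] He; first by rewrite expn0 dvd1z.
have /dvdzP[y Ey] : ((p ^ e)%N %| z)%Z by apply: IHe; apply: val_geW He; lia.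
suff /dvdzP[x Ex] : (p %| y)%Z.
  by rewrite Ey Ex expnS PoszM -mulrA dvdz_mull // dvdzz.
have cop : coprimez p y = ~~ (p %| y)%Z by rewrite coprimezE prime_coprime // dvdzE.
apply: contraT; rewrite -cop => /val_int_coprime[y0 vy].
move: He; rewrite Ey rmorphM /= -[(Posz _)%:~R]/((p ^ e)%N%:R) natrX => -[/eqP|].
  by rewrite mulf_eq0 (negPf y0) expf_eq0 (negPf pK_neq0) andbF.
by rewrite val_mul ?expf_neq0 ?pK_neq0 // val_pX vy; lia.
Qed.

(** A close rational q is itself p-integral, so p cannot divide its denominator, as it would then
    divide the numerator too. Replacing the denominator by its inverse modulo p^n gives an
    integer. *)
Lemma Zp_dense (x : K) (n : nat) : val_ge v x 0 -> exists z : int, val_ge v (x - z%:~R) n%:Z.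
Proof.
move=> x0; have [q Hq] : exists q : rat, val_ge v (x - iota q) n%:Z.
  by case: HK => _ _ _ H _; apply: H.
have q0 : val_ge v (iota q) 0.
  rewrite (_ : iota q = x - (x - iota q)); last by rewrite opprB addrCA subrr addr0.
  by apply: val_geD => //; apply: val_geN; apply: val_geW Hq.
have Eq : iota q * (denq q)%:~R = (numq q)%:~R.
  by rewrite -[RHS](rmorph_int iota) numqE rmorphM /= rmorph_int.
have cop : coprimez p (denq q).
  rewrite coprimezE prime_coprime //; apply/negP => pd.
  have : ((p ^ 1)%N %| numq q)%Z.
    apply: val_ge_dvd; rewrite -Eq; apply: val_geMl => //.
    have /dvdzP[d ->] : (p %| denq q)%Z by [].
    rewrite rmorphM /=; apply: val_geMl; first exact: val_ge_int.
    by right; rewrite val_p.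
  rewrite expn1 => pn.
  move/eqP: (coprime_num_den q) => g1.
  have : (p %| gcdn `|numq q| `|denq q|)%N by rewrite dvdn_gcd; apply/andP.
  by rewrite g1 dvdn1 => /eqP p1; move: Hp; rewrite p1.
have copn : coprimez (p ^ n)%N (denq q).
  by rewrite coprimezE coprimeXl // -[p]/(`|p%:Z|)%N -coprimezE.
have [[a b] /= Eab] := coprimezP _ _ copn.
exists (numq q * b); rewrite (_ : x - _ = (x - iota q) + (iota q - (numq q * b)%:~R)); last first.
  by rewrite addrA subrK.
apply: val_geD => //.
have -> : iota q - (numq q * b)%:~R = iota q * a%:~R * p%:R ^+ n.
  have E1 : a%:~R * p%:R ^+ n + b%:~R * (denq q)%:~R = 1 :> K.
    by rewrite -natrX -[(p ^ n)%:R]/((p ^ n)%N%:Z%:~R) -!rmorphM -rmorphD /= Eab.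
  by rewrite rmorphM /= -Eq -[X in X - _]mulr1 -[X in _ * X - _]E1; ring.
apply: val_geMl; last exact: val_ge_pX.
by apply: val_geMl => //; exact: val_ge_int.
Qed.

(** Coordinatewise lower bounds stand in for a valuation on K[i], which may be a product of two
    fields. *)
Definition gval (x : gauss K) (n : int) := val_ge v (gre x) n /\ val_ge v (gim x) n.

Lemma gvalD x y n : gval x n -> gval y n -> gval (x + y) n.
Proof. by move=> [? ?] [? ?]; split; apply: val_geD. Qed.
Lemma gvalN x n : gval x n -> gval (- x) n.
Proof. by move=> [? ?]; split; apply: val_geN. Qed.
Lemma gvalM x y m n : gval x m -> gval y n -> gval (x * y) (m + n).
Proof.
move=> [? ?] [? ?]; split; apply: val_geD; try apply: val_geN; exact: val_geM.
Qed.
Lemma gval_bar x n : gval x n -> gval (gbar x) n.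
Proof. by move=> [? ?]; split=> //; apply: val_geN. Qed.
Lemma gval_sum (I : finType) (F : I -> gauss K) n : (forall i, gval (F i) n) -> gval (\sum_i F i) n.
Proof.
move=> H; elim/big_ind: _ => //; first by split; left.
by move=> x y; apply: gvalD.
Qed.
Lemma gvalC (c : K) n : val_ge v c n -> gval (gC c) n.
Proof. by move=> ?; split=> //; left. Qed.
Lemma gval_int (x : gauss int) : gval (gint K x) 0.
Proof. by split; exact: val_ge_int. Qed.
Lemma gval_mulmx m n k (A : 'M_(m, n)) (B : 'M_(n, k)) a b :
  (forall i j, gval (A i j) a) -> (forall i j, gval (B i j) b) ->
  forall i j, gval ((A *m B) i j) (a + b).
Proof. by move=> HA HB i j; rewrite mxE; apply: gval_sum => l; apply: gvalM. Qed.
Lemma gval_mxstar m n (A : 'M_(m, n)) a :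
  (forall i j, gval (A i j) a) -> forall i j, gval (A^h i j) a.
Proof. by move=> HA i j; rewrite mxstarE; apply: gval_bar. Qed.

Lemma gval_dvg (x : gauss int) (e : nat) : gval (gint K x) e%:Z -> dvg (p ^ e)%N%:Z x.
Proof.
case=> /val_ge_dvd/dvdzP[a Ea] /val_ge_dvd/dvdzP[b Eb]; exists (Gauss a b).
by apply: gaussP; rewrite /= ?Ea ?Eb; ring.
Qed.

Lemma dvg_gval (x : gauss int) (e : nat) : dvg (p ^ e)%N%:Z x -> gval (gint K x) e%:Z.
Proof.
case=> y ->; rewrite rmorphM /= gintC -[e%:Z]addr0; apply: gvalM; last exact: gval_int.
by apply: gvalC; rewrite -[(Posz _)%:~R]/((p ^ e)%N%:R) natrX; exact: val_ge_pX.
Qed.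
Lemma mxBE (R : zmodType) m n (A B : 'M[R]_(m, n)) i j : (A - B) i j = A i j - B i j.
Proof. by rewrite mxE; congr (_ + _); rewrite mxE. Qed.

Lemma mxstar_gC (R : comNzRingType) n (l : R) : ((gC l)%:M : 'M_n)^h = (gC l)%:M.
Proof. by rewrite mxstar_scalar gbarC. Qed.

(** With e = v(l), the set [L] below is the trace on Z[i]^3 of the lattice spanned by the columns of
    [g], because g^-1 = l^-1 g^h. It is p^e-selfdual, hence spanned by some [A] with A A^h = p^e,
    and k = g^-1 A is an integral similitude. *)
Lemma integral_vertex (g : 'M[gauss K]_3) (l : K) : l != 0 ->
  (forall i j, gval (g i j) 0) -> g *m g^h = (gC l)%:M ->
  exists (A : 'M[gauss int]_3) (e : nat) (k : 'M[gauss K]_3),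
    [/\ A *m A^h = (gC (p ^ e)%N%:Z)%:M, GUM (Defs.Zp v) k & map_mx (@gint K) A = g *m k].
Proof.
move=> l0 g0 ggh; have ghg := scal_mulmxC l0 ggh.
have gh0 := gval_mxstar g0.
have [e vl] : exists e : nat, v l = e%:Z.
  have : gval ((g *m g^h) o0 o0) (0 + 0) by apply: gval_mulmx.
  rewrite ggh mxE eqxx mulr1n addr0 /gval greC => -[[E|vl] _]; first by rewrite E eqxx in l0.
  by exists (absz (v l)); rewrite gez0_abs.
pose q := (p ^ e)%N%:Z.
have q0 : 0 < q by rewrite /q ltz_nat expn_gt0 prime_gt0.
have qE : q%:~R = p%:R ^+ e :> K by rewrite -natrX.
have lval : val_ge v l e by right; rewrite vl.
have linv : gval (gC l^-1) (- e%:Z) by apply: gvalC; right; rewrite val_inv // vl.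
pose L (x : 'cV[gauss int]_3) := forall i j, gval ((g^h *m map_mx (@gint K) x) i j) e.
(* An integral approximation of [g] modulo p^e. Its columns lie in [L], as g^h Y is congruent to g^h
   g = l. *)
have [Y HY] : exists Y : 'M[gauss int]_3, forall i j, gval ((g - map_mx (@gint K) Y) i j) e.
  have /fin_choice[y Hy] : forall i : 'I_3, exists y : 'I_3 -> gauss int, forall j,
      gval (g i j - gint K (y j)) e.
    move=> i; apply: (@fin_choice _ _ (fun j x => gval (g i j - gint K x) e)) => j.
    have [[a Ha] [b Hb]] := (Zp_dense e (g0 i j).1, Zp_dense e (g0 i j).2).
    by exists (Gauss a b).
  by exists (\matrix_(i, j) y i j) => i j; rewrite !mxE.
have HYh : forall i j, gval ((g^h - (map_mx (@gint K) Y)^h) i j) e.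
  have -> : g^h - (map_mx (@gint K) Y)^h = (g - map_mx (@gint K) Y)^h.
    by apply/matrixP => i j; rewrite !mxE rmorphB.
  exact: gval_mxstar.
have LY j : L (col j Y).
  move=> i k; rewrite map_col colE mulmxA -colE mxE.
  have -> : g^h *m map_mx (@gint K) Y = (gC l)%:M - g^h *m (g - map_mx (@gint K) Y).
    by rewrite mulmxBr ghg opprB addrC subrK.
  rewrite mxBE; apply: gvalD.
    rewrite mxE; case: eqP => _; rewrite ?mulr1n ?mulr0n; first exact: gvalC.
    by split; left.
  by apply: gvalN; rewrite -[e%:Z]add0r; apply: gval_mulmx.
have Ldual x : L x <-> forall y, L y -> dvg q (gdot y x).
  split=> [Lx y Ly|dual].
    apply: (gval_dvg).
    have -> : gint K (gdot y x) = ((map_mx (@gint K) y)^h *m (map_mx (@gint K) x)) 0 0.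
      by rewrite -map_gint_star -map_mxM mxE.
    (* Here y^h x = l^-1 (g^h y)^h (g^h x), whose valuation is at least -e + e + e. *)
    have -> : (map_mx (@gint K) y)^h *m map_mx (@gint K) x = gC l^-1 *:
       ((g^h *m map_mx (@gint K) y)^h *m (g^h *m map_mx (@gint K) x)).
      rewrite mxstarM mxstarK mulmxA -[_ *m g *m _]mulmxA ggh mul_mx_scalar -scalemxAl scalerA.
      by rewrite -rmorphM /= mulVf // rmorph1 scale1r.
    rewrite mxE (_ : e%:Z = - e%:Z + (e%:Z + e%:Z)); last by lia.
    apply: gvalM; first exact: linv.
    by apply: gval_mulmx; [apply: gval_mxstar; exact: Ly | exact: Lx].
  (* Conversely, pairing x with the columns of [Y] shows that p^e divides Y^h x, and g^h is
     congruent to Y^h modulo p^e. *)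
  move=> i k; rewrite ord1.
  rewrite -[g^h](subrK (map_mx (@gint K) Y)^h) mulmxDl mxE; apply: gvalD.
    by rewrite -[e%:Z]addr0; apply: gval_mulmx => // a b; rewrite mxE; exact: gval_int.
  rewrite -map_gint_star -map_mxM mxE; apply: dvg_gval.
  have := dual _ (LY i); congr dvg; rewrite /gdot !mxE; apply: eq_bigr => a _.
  by rewrite !mxE.
have [A [AAh LA]] := selfdual_lattice q0 Ldual.
pose k := gC l^-1 *: (g^h *m map_mx (@gint K) A).
exists A, e, k; split=> //; last first.
  rewrite -scalemxAr mulmxA ggh mul_scalar_mx scalerA.
  by rewrite -rmorphM /= mulVf // rmorph1 scale1r.
split=> [i j|].
  suff : gval (k i j) (- e%:Z + e%:Z) by rewrite addNr.
  rewrite mxE; apply: gvalM => //.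
  have : L (A *m delta_mx j 0) by apply/LA; exists (delta_mx j 0).
  move=> /(_ i 0); rewrite map_mxM map_delta_mx mulmxA.
  by rewrite -colE mxE.
(* The multiplier of [k] is p^e / l, which has valuation 0. *)
have lq : l^-1 * q%:~R != 0 by rewrite mulf_neq0 ?invr_eq0 // qE expf_neq0 // pK_neq0.
have vlq : v (l^-1 * q%:~R) = 0.
  by rewrite val_mul ?invr_eq0 // ?qE ?expf_neq0 ?pK_neq0 // val_pX val_inv // vl addNr.
exists (l^-1 * q%:~R); split.
  split; first by right; rewrite vlq.
  by exists (l^-1 * q%:~R)^-1; split; [right; rewrite val_inv // vlq|rewrite mulfV].
rewrite /k mxstarZ gbarC -scalemxAr -scalemxAl mxstarM mxstarK mulmxA -[_ *m _ *m _^h]mulmxA.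
rewrite -map_gint_star -map_mxM AAh map_scalar_mx /= gintC mul_mx_scalar -scalemxAl ghg !scalerA.
rewrite scale_scalar_mx -!rmorphM /=; congr (gC _)%:M.
by rewrite -/q; field.
Qed.

(** * The group GU_3(Z_p) and the equivalence of vertices *)

Lemma Zp_mul x y : Defs.Zp v x -> Defs.Zp v y -> Defs.Zp v (x * y).
Proof. exact: (val_geMl). Qed.

Lemma GUM_gval g : GUM (Defs.Zp v) g -> forall i j, gval (g i j) 0.
Proof. by case. Qed.

Lemma GUM_mul g h : GUM (Defs.Zp v) g -> GUM (Defs.Zp v) h -> GUM (Defs.Zp v) (g *m h).
Proof.
move=> [g0 [l [[l0 [l' [l'0 ll']]] gl]]] [h0 [m [[m0 [m' [m'0 mm']]] hm]]].
split; first by move=> i j; have := gval_mulmx g0 h0 i j; rewrite addr0.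
exists (l * m); split.
  split; first exact: Zp_mul.
  by exists (l' * m'); split; [exact: Zp_mul | rewrite mulrACA ll' mm' mulr1].
rewrite mxstarM mulmxA -[g *m h *m _]mulmxA hm mul_mx_scalar -scalemxAl gl.
by rewrite scale_scalar_mx -rmorphM mulrC.
Qed.

Lemma GUM_inv g : GUM (Defs.Zp v) g -> exists g', GUM (Defs.Zp v) g' /\ g *m g' = 1%:M.
Proof.
move=> [g0 [l [[l0 [l' [l'0 ll']]] gl]]].
have l_neq0 : l != 0 by apply/eqP => E; move/eqP: ll'; rewrite E mul0r eq_sym oner_eq0.
exists (gC l' *: g^h); split; last first.
  by rewrite -scalemxAr gl scale_scalar_mx -rmorphM mulrC ll'.
split.
  move=> i j; rewrite mxE.
  by have := gvalM (gvalC l'0) (gval_mxstar g0 i j); rewrite addr0.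
exists l'; split; first by split=> //; exists l; rewrite mulrC.
rewrite mxstarZ gbarC mxstarK -scalemxAr -scalemxAl (scal_mulmxC l_neq0 gl) !scale_scalar_mx.
by rewrite -!rmorphM /= -[l' * (l' * l)]mulrCA [l' * l]mulrC ll' mulr1.
Qed.

Lemma same_vertex_mul (g k : 'M_3) : GUM (Defs.Zp v) k -> same_vertex v g (g *m k).
Proof. by move=> Hk; exists 1, 1, k; rewrite mulr1 scale1r. Qed.

Lemma GUM_one : GUM (Defs.Zp v) 1%:M.
Proof.
split=> [i j|].
  by rewrite mxE; case: eqP => _; split; try (by left); exact: (val_ge_one).
exists 1; split; last by rewrite mul1mx; exact: (mxstar_gC _ (1 : K)).
by split; [exact: (val_ge_one) | exists 1; split; [exact: (val_ge_one)|rewrite mulr1]].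
Qed.

Lemma same_vertex_scale (g : 'M_3) c d : c * d = 1 -> same_vertex v g (c *: g).
Proof. by move=> cd; exists c, d, 1%:M; split=> //; split; [exact: GUM_one|rewrite mulmx1]. Qed.

Lemma same_vertex_sym (g h : 'M_3) : same_vertex v g h -> same_vertex v h g.
Proof.
move=> [c [d [k [cd [/GUM_inv [k' [Hk' kk']] ->]]]]]; exists d, c, k'.
split; first by rewrite mulrC.
split=> //.
by rewrite -scalemxAl -mulmxA kk' mulmx1 scalerA mulrC cd scale1r.
Qed.

Lemma same_vertex_trans (f g h : 'M_3) :
  same_vertex v f g -> same_vertex v g h -> same_vertex v f h.
Proof.
move=> [c [d [k [cd [Hk ->]]]]] [c' [d' [k' [cd' [Hk' ->]]]]].
exists (c * c'), (d * d'), (k *m k'); split; first by rewrite mulrACA cd cd' mulr1.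
split; first exact: GUM_mul.
by rewrite -scalemxAl scalerA mulrC mulmxA.
Qed.

Lemma same_vertex_mull (x g h : 'M_3) :
  same_vertex v g h -> same_vertex v (x *m g) (x *m h).
Proof.
move=> [c [d [k [cd [Hk ->]]]]]; exists c, d, k; split=> //; split=> //.
by rewrite -scalemxAr mulmxA.
Qed.

(** A power of p clears the denominators of [g] and, being scalar, does not move its vertex. *)
Lemma GU_vertex (g : 'M[gauss K]_3) (l : K) : l != 0 -> g *m g^h = (gC l)%:M ->
  exists (A : 'M[gauss int]_3) (e : nat),
    A *m A^h = (gC (p ^ e)%N%:Z)%:M /\ same_vertex v g (map_mx (@gint K) A).
Proof.
move=> l0 gl.
have [N HN] : exists N : nat, forall i j, gval (gC (p%:R ^+ N) * g i j) 0.
  have one (x : K) : exists N : nat, forall M, (N <= M)%N -> val_ge v (p%:R ^+ M * x) 0.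
    exists (absz (v x)) => M HM; have [->|x0] := eqVneq x 0; first by left; rewrite mulr0.
    right; rewrite (val_mul) ?(expf_neq0, pK_neq0) // (val_pX).
    by move: HM; lia.
  have /fin_choice[N1 HN1] : forall ij : 'I_3 * 'I_3, exists N : nat, forall M, (N <= M)%N ->
      gval (gC (p%:R ^+ M) * g ij.1 ij.2) 0.
    move=> [i j] /=; have [[a Ha] [b Hb]] := (one (gre (g i j)), one (gim (g i j))).
    exists (maxn a b) => M; rewrite geq_max => /andP[aM bM].
    by split; rewrite /= !gE mul0r ?subr0 ?addr0; [apply: Ha | apply: Hb].
  by exists (\max_ij N1 ij)%N => i j; apply: (HN1 (i, j)); apply: leq_bigmax.
pose P : K := p%:R ^+ N; have P0 : P != 0 by rewrite expf_neq0 // pK_neq0.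
have gl' : (gC P *: g) *m (gC P *: g)^h = (gC (P * P * l))%:M.
  by rewrite mxstarZ gbarC -scalemxAr -scalemxAl gl !scale_scalar_mx -!rmorphM mulrA.
have [|i j|A [e [k [Ae Hk Ak]]]] := @integral_vertex _ (P * P * l) _ _ gl'.
- by rewrite !mulf_neq0.
- by rewrite mxE.
exists A, e; split=> //; rewrite Ak; apply: same_vertex_trans (same_vertex_mul _ Hk).
apply: (@same_vertex_scale _ _ (gC P^-1)).
by rewrite -rmorphM mulfV.
Qed.

(** Write A = c x with x in GU_3(Z_p) of multiplier m. Then c conj(c) = p^e / m, and this factor
    occurs in every product A_ij conj(A_kl). *)
Lemma stabilizer_dvg (A : 'M[gauss int]_3) (e : nat) :
  A *m A^h = (gC (p ^ e)%N%:Z)%:M -> same_vertex v 1%:M (map_mx (@gint K) A) ->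
  forall i j k l, dvg (p ^ e)%N%:Z (A i j * gbar (A k l)).
Proof.
move=> Ae [c [d [x [cd [Hx E]]]]] i j k l; rewrite mul1mx in E.
apply: (gval_dvg); rewrite rmorphM /= gint_bar.
have Ex a b : gint K (A a b) = c * x a b.
  by have /matrixP/(_ a b) := E; rewrite !mxE.
case: (Hx) => x0 [m [[m0 [m' [m'0 mm']]] xm]].
have cc : c * gbar c = gC ((p ^ e)%N%:R * m').
  have : map_mx (@gint K) A *m (map_mx (@gint K) A)^h = (gC (p ^ e)%N%:R)%:M.
    by rewrite -map_gint_star -map_mxM Ae map_scalar_mx /= gintC.
  rewrite E mxstarZ -scalemxAr -scalemxAl xm !scale_scalar_mx.
  move/matrixP/(_ o0 o0); rewrite !mxE eqxx !mulr1n => E0.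
  have mm : gC m * gC m' = 1 by rewrite -rmorphM mm' rmorph1.
  by rewrite rmorphM /= -E0 -[LHS]mulr1 -mm; ring.
have -> : gint K (A i j) * gbar (gint K (A k l)) =
    gC (p ^ e)%N%:R * (gC m' * (x i j * gbar (x k l))).
  by rewrite !Ex rmorphM /= mulrACA cc rmorphM /= -!mulrA.
have z0 : gval (gC m' * (x i j * gbar (x k l))) (0 + (0 + 0)).
  apply: gvalM; first exact: gvalC.
  by apply: gvalM; [exact: (GUM_gval Hx) | apply: gval_bar; exact: (GUM_gval Hx)].
rewrite -[e%:Z]addr0; apply: gvalM; last exact: z0.
by apply: gvalC; rewrite natrX; exact: val_ge_pX.
Qed.
End Local.

(** * Congruences modulo 2 + 2i *)

Definition tau_multiple (x : gauss int) := exists z, x = Gauss 2 2 * z.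
(** The classical primary Gaussian integers: they single out one associate of each odd element. *)
Definition primary (x : gauss int) := tau_multiple (x - 1).

Lemma primaryE x : primary x <-> cong1 (gre x) (gim x).
Proof.
split=> [[[a b] E]|[a [b [Ea Eb]]]].
  exists a, b; move/(congr1 (fun y => (gre y, gim y))): E => [] /=; lia.
by exists (Gauss a b); apply: gaussP; rewrite /=; lia.
Qed.

Lemma tau_multipleD x y : tau_multiple x -> tau_multiple y -> tau_multiple (x + y).
Proof. by move=> [a ->] [b ->]; exists (a + b); rewrite mulrDr. Qed.

Lemma tau_multipleM x y : tau_multiple x -> tau_multiple (x * y).
Proof. by move=> [a ->]; exists (a * y); rewrite mulrA. Qed.

Lemma primaryM x y : primary x -> primary y -> primary (x * y).
Proof.
move=> Px Py; rewrite /primary (_ : x * y - 1 = (x - 1) * y + (y - 1)); last by ring.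
by apply: tau_multipleD => //; apply: tau_multipleM.
Qed.

Lemma primary_bar x : primary x -> primary (gbar x).
Proof.
(* The conjugate of 2 + 2i is -i (2 + 2i). *)
move=> [z E]; exists (Gauss 0 (- 1) * gbar z).
rewrite -(rmorph1 (@gbar int)) -rmorphB /= E rmorphM /=.
by rewrite mulrA; congr (_ * _); apply: gaussP; rewrite /=; ring.
Qed.

Lemma primary_gN x : primary x -> exists t, gN x = 1 + 4 * t.
Proof.
move/primaryE => [a [b [Ea Eb]]].
exists (a - b + 2 * a ^+ 2 + 2 * b ^+ 2); rewrite /gN Eb.
have -> : gre x = 1 + 2 * a - 2 * b by lia.
ring.
Qed.

(** Squares are 0 or 1 modulo 4, so four of them sum to 0 modulo 4 only when all four terms have the
    same parity. *)
Lemma four_squares_parity (x1 x2 y1 y2 s : int) :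
  x1 ^+ 2 + x2 ^+ 2 + (y1 ^+ 2 + y2 ^+ 2) = 4 * s ->
  exists e a1 a2 b1 b2,
    [/\ x1 = 2 * a1 + e, x2 = 2 * a2 + e, y1 = 2 * b1 + e & y2 = 2 * b2 + e].
Proof.
have par (x : int) : exists a, x = 2 * a \/ x = 2 * a + 1.
  by exists (x %/ 2)%Z; lia.
have [[a1 A1] [a2 A2] [b1 B1] [b2 B2]] := And4 (par x1) (par x2) (par y1) (par y2).
have sq0 a : (2 * a) ^+ 2 = 4 * (a ^+ 2) :> int by ring.
have sq1 a : (2 * a + 1) ^+ 2 = 4 * (a ^+ 2 + a) + 1 :> int by ring.
by case: A1 => ->; case: A2 => ->; case: B1 => ->; case: B2 => ->; rewrite ?sq0 ?sq1 => E;
  try (by lia); [exists 0 | exists 1]; exists a1, a2, b1, b2; split; lia.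
Qed.

(** By parity x = 2a + e(1+i), y = 2b + e(1+i), u = 2c + f(1+i) and w = 2d + f(1+i). Expanding x u +
    y w gives the quotient by 2 + 2i supplied below, namely (1-i)(ac+bd) + f(a+b) + e(c+d) +
    ef(1+i). *)
Lemma tau_multiple_cross (x y u w : gauss int) (s t : int) :
  gN x + gN y = 4 * s -> gN u + gN w = 4 * t -> tau_multiple (x * u + y * w).
Proof.
case: x y u w => [x1 x2] [y1 y2] [u1 u2] [w1 w2]; rewrite /gN /=.
move=> /four_squares_parity [e [a1 [a2 [b1 [b2 [-> -> -> ->]]]]]].
move=> /four_squares_parity [f [c1 [c2 [d1 [d2 [-> -> -> ->]]]]]].
exists (Gauss
  (a1 * (c1 + c2 + f) + a2 * (c1 - c2) + b1 * (d1 + d2 + f) + b2 * (d1 - d2) + e * (c1 + d1 + f))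
  (a1 * (c2 - c1) + a2 * (c1 + c2 + f) + b1 * (d2 - d1) + b2 * (d1 + d2 + f) + e * (c2 + d2 + f))).
by apply: gaussP; rewrite /=; ring.
Qed.

Definition primary_mx (q : int) (A : 'M[gauss int]_3) :=
  A *m A^h = (gC q)%:M /\ forall i, primary (A i i).

Lemma row_norm (q : int) (A : 'M[gauss int]_3) i : A *m A^h = (gC q)%:M ->
  gN (A i o0) + gN (A i o1) + gN (A i o2) = q.
Proof.
move=> /matrixP/(_ i i); rewrite mxE sum3 !mxstarE !mul_gbar !mxE eqxx mulr1n -!rmorphD.
by move/gC_inj.
Qed.

Lemma primary_mx_star q A : q != 0 -> primary_mx q A -> primary_mx q A^h.
Proof.
move=> q0 [Aq Ad]; split; first by rewrite mxstarK (scal_mulmxC q0 Aq).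
by move=> i; rewrite mxstarE; apply: primary_bar.
Qed.

(** Row norms and norms of primary diagonal entries are 1 modulo 4, so the off-diagonal norms in
    each row of [A] and each column of [B] sum to a multiple of 4. By [tau_multiple_cross] a
    diagonal entry of A B is then congruent to the product of the diagonal entries. *)
Lemma primary_mx_mul q r A B : r != 0 -> (exists s, q = 1 + 4 * s) -> (exists s, r = 1 + 4 * s) ->
  primary_mx q A -> primary_mx r B -> primary_mx (q * r) (A *m B).
Proof.
move=> r0 [s qs] [t rt] HA HB; have HBs := primary_mx_star r0 HB.
have offrow (C : 'M[gauss int]_3) m : primary_mx (1 + 4 * m) C ->
    [/\ exists s, gN (C o0 o1) + gN (C o0 o2) = 4 * s,
        exists s, gN (C o1 o0) + gN (C o1 o2) = 4 * s &
        exists s, gN (C o2 o0) + gN (C o2 o1) = 4 * s].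
  move=> [Cq Cd]; split.
  - have [k Hk] := primary_gN (Cd o0); exists (m - k); have := row_norm o0 Cq; lia.
  - have [k Hk] := primary_gN (Cd o1); exists (m - k); have := row_norm o1 Cq; lia.
  - have [k Hk] := primary_gN (Cd o2); exists (m - k); have := row_norm o2 Cq; lia.
rewrite qs in HA; rewrite rt in HBs.
have [[a0 A0] [a1 A1] [a2 A2]] := offrow _ _ HA.
have [[b0 B0] [b1 B1] [b2 B2]] := offrow _ _ HBs.
rewrite !mxstarE !gN_bar in B0 B1 B2.
split.
  case: HA => Aq _; case: HB => Bq _.
  rewrite mxstarM mulmxA -[A *m B *m _]mulmxA Bq mul_mx_scalar -scalemxAl Aq -qs.
  by rewrite scale_scalar_mx -rmorphM mulrC.
case: HA => _ Ad; case: HB => _ Bd.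
have comb x y z w : primary x -> tau_multiple (y + z) -> w = x + y + z -> primary w.
  move=> Px Pyz ->; rewrite /primary (_ : _ - 1 = x - 1 + (y + z)); last by ring.
  exact: tau_multipleD.
apply: forall3; rewrite mxE sum3.
- by apply: comb (primaryM (Ad o0) (Bd o0)) (tau_multiple_cross A0 B0) _.
- by apply: comb (primaryM (Ad o1) (Bd o1)) (tau_multiple_cross A1 B1) _; ring.
- by apply: comb (primaryM (Ad o2) (Bd o2)) (tau_multiple_cross A2 B2) _; ring.
Qed.

Lemma primary_associate (x : gauss int) : parity x != 0 ->
  exists u, u * gbar u = 1 /\ primary (x * u).
Proof.
have half (a : int) : exists k, a = 2 * k \/ a = 2 * k + 1.
  by exists (a %/ 2)%Z; lia.
have F0 k : (2 * k)%:~R = 0 :> 'F_2.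
  by rewrite rmorphM /= (_ : 2%:~R = 0) ?mul0r //; apply/eqP.
(* An element 2a + 1 + 2bi is primary exactly when a + b is even, and otherwise its negative is.
   When the imaginary part is the odd one, a factor -i reduces to this case. *)
have key (a b : int) : exists u : gauss int, u * gbar u = 1 /\ primary (Gauss (2 * a + 1) (2 * b) * u).
  have [k [E|E]] := half (a + b).
    exists 1; split; first by rewrite rmorph1 mulr1.
    by exists (Gauss k (b - k)); apply: gaussP; rewrite /=; lia.
  exists (- 1); split; first by rewrite rmorphN rmorph1 mulrNN mulr1.
  by exists (Gauss (- k - 1) (k + 1 - b)); apply: gaussP; rewrite /=; lia.
case: x => a b; rewrite /parity /=.
have [a' [->|->]] := half a; have [b' [->|->]] := half b.
- by rewrite -mulrDr F0 eqxx.
- move=> _; have [u [uu Pu]] := key b' (- a'); exists (Gauss 0 (- 1) * u); split.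
    by rewrite rmorphM mulrACA uu mulr1; apply: gaussP; rewrite /=; ring.
  rewrite mulrA; congr (primary (_ * _)): Pu.
  by apply: gaussP; rewrite /=; ring.
- by move=> _; apply: key.
- by rewrite (_ : 2 * a' + 1 + (2 * b' + 1) = 2 * (a' + b' + 1)) ?F0 ?eqxx //; ring.
Qed.

(* The Leibniz expansion of the odd determinant contains a term all of whose factors are odd. *)
Lemma odd_transversal (q : int) (A : 'M[gauss int]_3) : q%:~R != 0 :> 'F_2 ->
  A *m A^h = (gC q)%:M -> exists s : 'S_3, forall i, parity (A i (s i)) != 0.
Proof.
move=> qodd Aq.
have detA : parity (\det A) != 0.
  have : \det A * gbar (\det A) = gC (q ^+ 3).
    by rewrite -det_mxstar -det_mulmx Aq det_scalar -rmorphXn.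
  rewrite mul_gbar => /gC_inj E; rewrite parity_gN E rmorphXn /=.
  exact: expf_neq0.
have [/existsP[s /forallP Hs]|none] :=
  boolP [exists s : 'S_3, [forall i, parity (A i (s i)) != 0]]; first by exists s.
case/negP: detA; rewrite /determinant rmorph_sum big1 // => s _.
move: none; rewrite negb_exists => /forallP/(_ s); rewrite negb_forall => /existsP[i].
rewrite negbK => /eqP Ei; rewrite rmorphM rmorph_prod /= (bigD1 i) //= Ei.
by rewrite mul0r mulr0.
Qed.

(** The monomial matrix [W] moves an odd transversal of [A] to the diagonal and multiplies each
    column by the unit making its diagonal entry primary. *)
Lemma primary_normalization (q : int) (A : 'M[gauss int]_3) : q%:~R != 0 :> 'F_2 ->
  A *m A^h = (gC q)%:M ->
  exists W : 'M_3, W *m W^h = 1%:M /\ primary_mx q (A *m W).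
Proof.
move=> qodd Aq; have [s Hs] := odd_transversal qodd Aq.
have /fin_choice[u Hu] : forall i : 'I_3, exists u : gauss int,
    u * gbar u = 1 /\ primary (A i (s i) * u).
  by move=> i; apply: primary_associate.
pose W : 'M_3 := \matrix_(i, j) if i == s j then u j else 0.
have WW : W *m W^h = 1%:M.
  apply: mulmx1C; apply/matrixP => i j; rewrite !mxE (bigD1 (s i)) //= big1 => [|k ks].
    rewrite !mxE eqxx addr0 (inj_eq perm_inj) mulrC.
    case: eqP => [->|_]; last by rewrite mul0r.
    exact: (Hu j).1.
  by rewrite !mxE (negPf ks) rmorph0 mul0r.
exists W; split=> //; split.
  by rewrite mxstarM mulmxA -[A *m W *m _]mulmxA WW mulmx1.
move=> i; rewrite mxE (bigD1 (s i)) //= big1 => [|k ks].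
  by rewrite mxE eqxx addr0; apply: (Hu i).2.
by rewrite mxE (negPf ks) mulr0.
Qed.

(** For u = 1 + (2+2i)(a+bi) of norm 1 one finds 2a^2 + 2b^2 + a - b = 0; since |a| <= a^2 and |b|
    <= b^2, both vanish. *)
Lemma primary_unit (u : gauss int) : gN u = 1 -> primary u -> u = 1.
Proof.
move=> Nu /primaryE [a [b [Ea Eb]]].
have E : 2 * (a * a) + 2 * (b * b) + a - b = 0.
  have Er : gre u = 1 + 2 * a - 2 * b by lia.
  move: Nu; rewrite /gN Er Eb => N4.
  suff : 4 * (2 * (a * a) + 2 * (b * b) + a - b) = 0 by lia.
  by apply: (addrI 1); rewrite addr0 -[in RHS]N4; ring.
have Sq (x : int) : `|x| <= x * x.
  have [->|x0] := eqVneq x 0; first by lia.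
  rewrite -expr2 -real_normK ?num_real // -[X in X <= _]mulr1 expr2.
  by apply: ler_wpM2l => //; lia.
have [a0 b0] : a = 0 /\ b = 0 by have := Sq a; have := Sq b; lia.
by apply: gaussP; rewrite /=; lia.
Qed.

(** As q divides N(A_ij), each entry is zero or has norm at least q, the norm of a whole row.
    Diagonal entries are odd, hence nonzero, so the others vanish. Then u = A_ii conj(A_jj) / q is
    the quotient A_ii / A_jj, a primary unit. *)
Lemma primary_scalar (q : int) (A : 'M[gauss int]_3) : 0 < q -> (exists s, q = 1 + 4 * s) ->
  primary_mx q A -> (forall i j k l, dvg q (A i j * gbar (A k l))) ->
  exists a, A = a%:M.
Proof.
move=> q0 [s qs] [Aq Ad] Hdvg.
have big_norm i j : A i j = 0 \/ q <= gN (A i j).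
  have [z] := Hdvg i j i j; rewrite mul_gbar => E.
  have Ere : gN (A i j) = q * gre z by move/(congr1 (@gre _)): E; rewrite /=; lia.
  have [z0|z0] := leP (gre z) 0.
    by left; apply: gN_eq0; apply/eqP; rewrite eq_le gN_ge0 andbT Ere pmulr_rle0.
  by right; rewrite Ere -[X in X <= _]mulr1 ler_pM2l //; lia.
pose N i j := gN (A i j).
have rowN i : N i o0 + N i o1 + N i o2 = q by exact: row_norm.
have N0 i j : 0 <= N i j by exact: gN_ge0.
have diag_neq0 i : q <= gN (A i i).
  have [E|//] := big_norm i i; have [t] := primary_gN (Ad i).
  by rewrite E /gN /= expr0n; lia.
have off i j : i != j -> A i j = 0.
  move=> ij; have [//|Nij] := big_norm i j; exfalso.
  move: (diag_neq0 i) Nij (rowN i); rewrite -/(N i i) -/(N i j).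
  by move: i j ij; apply: forall3; apply: forall3 => //= _; move: (N0 o0 o0) (N0 o0 o1) (N0 o0 o2) (N0 o1 o0) (N0 o1 o1) (N0 o1 o2) (N0 o2 o0) (N0 o2 o1) (N0 o2 o2); lia.
have diag_norm i : gN (A i i) = q.
  have Nz k l : k != l -> N k l = 0 by move=> kl; rewrite /N off // /gN /= expr0n.
  rewrite -/(N i i); have := rowN i; move: i.
  apply: forall3.
  - by rewrite (Nz o0 o1) // (Nz o0 o2) // !addr0.
  - by rewrite (Nz o1 o0) // (Nz o1 o2) // add0r addr0.
  - by rewrite (Nz o2 o0) // (Nz o2 o1) // !add0r.
have qn0 : q != 0 by lia.
have eq_diag i j : A i i = A j j.
  have [u Eu] := Hdvg i i j j.
  have Nu : gN u = 1.
    have : gN (A i i) * gN (gbar (A j j)) = gN (gC q * u) by rewrite -gNM Eu.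
    rewrite gN_bar !diag_norm gNM gNC expr2 -[LHS]mulr1 => /mulfI ->//.
    by rewrite mulf_neq0.
  have Pu : primary u.
    have [t Et] : primary (gC q * u) by rewrite -Eu; apply: primaryM => //; apply: primary_bar.
    (* Since q = 1 + 4s, u differs from the primary element q u by 4 s u, and 4 = (2+2i)(1-i). *)
    rewrite /primary (_ : u - 1 = gC q * u - 1 + - (gC 4 * gC s) * u).
      apply: tau_multipleD; first by exists t.
      exists (- (Gauss 1 (- 1) * gC s * u)); apply: gaussP; rewrite /=; ring.
    by rewrite qs; apply: gaussP; rewrite /=; ring.
  have u1 := primary_unit Nu Pu.
  apply/eqP; rewrite -subr_eq0; apply/eqP; apply: (gC_mul_eq0 qn0).
  have E : gC q * A i i = A j j * (A i i * gbar (A j j)).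
    by rewrite -{1}(diag_norm j) -mul_gbar; ring.
  by rewrite mulrBr E Eu u1 mulr1 mulrC subrr.
exists (A o0 o0); apply/matrixP => i j; rewrite !mxE.
have [->|ij] := eqVneq i j; first by rewrite mulr1n.
by rewrite mulr0n off.
Qed.

(** * Splitting off a factor of norm p' *)

Lemma gdotDl n (x y a : 'cV[gauss int]_n) : gdot (x + y) a = gdot x a + gdot y a.
Proof. by rewrite gdot_sym gdotD rmorphD /= -!gdot_sym. Qed.
Lemma gdotZl n (x a : 'cV[gauss int]_n) c : gdot (c *: x) a = gbar c * gdot x a.
Proof. by rewrite gdot_sym gdotZ rmorphM /= -gdot_sym. Qed.
Lemma gdot_image n (q : int) (A : 'M[gauss int]_n) x y : q != 0 -> A *m A^h = (gC q)%:M ->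
  gdot (A *m x) (A *m y) = gC q * gdot x y.
Proof.
move=> q0 Aq; rewrite /gdot mxstarM mulmxA -[_ *m A^h *m A]mulmxA (scal_mulmxC q0 Aq).
by rewrite mul_mx_scalar -scalemxAl mxE.
Qed.

Lemma dvgP (q : int) x : dvg q x <-> (q %| gre x)%Z /\ (q %| gim x)%Z.
Proof.
split=> [[y ->]|[/dvdzP[a Ea] /dvdzP[b Eb]]].
  by split; apply/dvdzP; [exists (gre y) | exists (gim y)]; rewrite /=; ring.
by exists (Gauss a b); apply: gaussP; rewrite /= ?Ea ?Eb; ring.
Qed.

(** * Orthogonality over F[i] in real coordinates *)

Section LinearAlgebra.
Variable F : fieldType.

Definition realify (x : 'cV[gauss F]_3) : 'rV[F]_(3 + 3) :=
  row_mx (\row_i gre (x i 0)) (\row_i gim (x i 0)).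
Definition complexify (a : 'rV[F]_(3 + 3)) : 'cV[gauss F]_3 :=
  \col_i Gauss (a 0 (lshift 3 i)) (a 0 (rshift 3 i)).

Lemma realifyK : cancel realify complexify.
Proof.
move=> x; apply/matrixP => i k; rewrite ord1 !mxE (unsplitK (inl i)) (unsplitK (inr i)) !mxE.
exact: gaussP.
Qed.

Lemma complexifyK : cancel complexify realify.
Proof.
move=> a; rewrite -[RHS]hsubmxK; congr row_mx; apply/rowP => i; rewrite !mxE //.
Qed.

Lemma realify_dot x y : (realify x *m (realify y)^T) 0 0 = gre ((x^h *m y) 0 0).
Proof.
rewrite tr_row_mx mul_row_col !mxE raddf_sum -big_split /=; apply: eq_bigr => i _.
by rewrite !mxE /=; ring.
Qed.

Lemma realifyD x y : realify (x + y) = realify x + realify y.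
Proof.
by rewrite /realify add_row_mx; congr row_mx; apply/rowP => i; rewrite !mxE.
Qed.

Lemma realifyZ c x : realify (gC c *: x) = c *: realify x.
Proof.
rewrite /realify scale_row_mx; congr row_mx; apply/rowP => i; rewrite !mxE /=; ring.
Qed.

(** The image of [A] is the orthogonal of the kernel of [A^h]. As F[i] may fail to be a field, the
    argument runs over [F] in six coordinates: [realify_dot] turns the pairing into the dot product,
    and columns of the cokernel matrix supply the test vectors. *)
Lemma image_of_biorthogonal (A : 'M[gauss F]_3) (x : 'cV_3) :
  (forall t : 'cV_3, A^h *m t = 0 -> (t^h *m x) 0 0 = 0) -> exists z : 'cV_3, x = A *m z.
Proof.
move=> Hx; pose f a := realify (A *m complexify a).
have f_lin : linear f.
  move=> c a b; rewrite /f -realifyZ -realifyD scalemxAr -mulmxDr; congr (realify (_ *m _)).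
  by apply/matrixP => i k; rewrite !mxE; apply: gaussP; rewrite /=; ring.
pose fL : {linear 'rV_(3 + 3) -> 'rV_(3 + 3)} :=
  HB.pack f (GRing.isLinear.Build F _ _ _ f f_lin).
pose M := lin1_mx fL.
have ME a : a *m M = f a by rewrite mul_rV_lin1.
have /submxP[a Ea] : (realify x <= M)%MS.
  rewrite submxE; apply/eqP/rowP => k; rewrite [RHS]mxE.
  pose t := complexify (col k (cokermx M))^T.
  have tE : (realify t)^T = col k (cokermx M) by rewrite complexifyK trmxK.
  have colk (u : 'rV_(3 + 3)) : (u *m cokermx M) 0 k = (u *m (realify t)^T) 0 0.
    by rewrite tE !mxE; apply: eq_bigr => l _; rewrite !mxE.
  have At (z : 'cV_3) : gre (((A *m z)^h *m t) 0 0) = 0.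
    have <- := realify_dot (A *m z) t.
    by rewrite -colk -[z]realifyK -/(f _) -ME -mulmxA mulmx_coker mulmx0 mxE.
  rewrite colk realify_dot.
  have -> : (x^h *m t) 0 0 = gbar ((t^h *m x) 0 0) by rewrite -mxstarE mxstarM mxstarK.
  rewrite Hx ?rmorph0 //; apply/matrixP => i l; rewrite ord1 [RHS]mxE.
  pose d : 'cV[gauss F]_3 := delta_mx i 0.
  have Ei : (A^h *m t) i 0 = ((A *m d)^h *m t) 0 0.
    rewrite (mxstarM A d) -mulmxA [RHS]mxE (bigD1 i) //= big1 => [|m mi].
      by rewrite mxstarE [d i 0]mxE !eqxx rmorph1 mul1r addr0.
    by rewrite mxstarE [d m 0]mxE (negPf mi) rmorph0 mul0r.
  (* Pairing with A d gives the real part of the entry of A^h t, and pairing with A (i d) its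
     imaginary part. *)
  apply: gaussP; first by rewrite Ei; exact: At.
  have := At (Gauss 0 1 *: d).
  rewrite -scalemxAr mxstarZ -scalemxAl mxE -Ei /=.
  by move=> E; rewrite -[RHS]E; ring.
by exists (complexify a); rewrite -[x]realifyK Ea ME /f realifyK.
Qed.
End LinearAlgebra.

(** * Reduction modulo p and the split and inert factorizations *)

Section ModP.
Variables (p : nat) (Hp : prime p).

Lemma intFp_eq0 (z : int) : (z%:~R == 0 :> 'F_p) = (p %| z)%Z.
Proof. by rewrite (dvdz_pcharf (pchar_Fp Hp)). Qed.

(** With p = 4k + 1, every nonzero x has x^(4k) = 1. If some x^(2k) differs from 1 it equals -1, and
    x^k is the root; otherwise X^(2k) - 1 would have 4k roots. *)
Lemma sqrt_opp1 : (p %% 4 = 1)%N -> exists j : 'F_p, j ^+ 2 = - 1.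
Proof.
move=> p1; pose k := (p %/ 4)%N; have pk : p = (4 * k).+1 by rewrite [LHS](divn_eq p 4) p1 mulnC addn1.
have k0 : (0 < k)%N by case: (k) pk Hp => // ->.
have fer (x : 'F_p) : x != 0 -> x ^+ (4 * k) = 1.
  move=> x0; apply: (mulfI x0); rewrite -exprS -pk mulr1.
  by rewrite -[in X in x ^+ X = _](card_Fp Hp) expf_card.
have [/existsP[x /andP[x0 xk]]|] := boolP [exists x : 'F_p, (x != 0) && (x ^+ (2 * k) != 1)].
  exists (x ^+ k); rewrite -exprM mulnC; have := fer x x0.
  rewrite (_ : 4 * k = 2 * k * 2)%N; last by lia.
  rewrite exprM => /eqP.
  by rewrite sqrf_eq1 (negPf xk) => /eqP.
rewrite negb_exists => /forallP none.
pose P : {poly 'F_p} := 'X^(2 * k) - 1%:P.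
have szP : size P = (2 * k).+1 by rewrite size_XnsubC // muln_gt0.
have P0 : P != 0 by rewrite -size_poly_eq0 szP.
have /(max_poly_roots P0) : all (root P) (enum [set~ (0 : 'F_p)]).
  apply/allP => x; rewrite mem_enum !inE => x0; rewrite /root !hornerE subr_eq0.
  by have := none x; rewrite x0 negbK.
rewrite enum_uniq => /(_ isT); rewrite -cardE cardsC1 card_Fp // szP pk /=.
by rewrite ltnS leq_pmul2r.
Qed.

Section Split.
Variables (j : 'F_p) (Hj : j ^+ 2 = - 1) (Hodd : odd p).

(* Reduction modulo the prime (p, i - j) of Z[i]. *)
Definition phi (x : gauss int) : 'F_p := (gre x)%:~R + j * (gim x)%:~R.

Lemma phiM x y : phi (x * y) = phi x * phi y.
Proof.
rewrite /phi /= rmorphB rmorphD !rmorphM /=.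
transitivity ((gre x)%:~R * (gre y)%:~R + j ^+ 2 * ((gim x)%:~R * (gim y)%:~R)
  + j * ((gre x)%:~R * (gim y)%:~R + (gim x)%:~R * (gre y)%:~R) : 'F_p).
  by rewrite Hj; ring.
ring.
Qed.

Lemma two_neq0 : (2%:R : 'F_p) != 0.
Proof.
rewrite -[2%:R]/(2%:Z%:~R) intFp_eq0; apply/negP; rewrite dvdzE /= => /dvdn_leq.
by move=> /(_ isT); case: (p) Hp Hodd => [|[|[|]]].
Qed.

Lemma j_neq0 : j != 0.
Proof. by apply: contraTneq (oner_neq0 'F_p) => E; rewrite -(opprK 1) -Hj E expr0n oppr0 eqxx. Qed.

(** [phi] and its composite with conjugation are the two projections of Z[i]/p = F_p x F_p. Their
    sum is twice the real part, and 2 and j are invertible. *)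
Lemma phi_dvg x : dvg p x <-> phi x = 0 /\ phi (gbar x) = 0.
Proof.
split=> [/dvgP[]|[]].
  rewrite -!intFp_eq0 => /eqP E1 /eqP E2.
  by rewrite /phi /= rmorphN /= E1 E2; split; ring.
rewrite /phi /= rmorphN /= => E1 E2; apply/dvgP; rewrite -!intFp_eq0.
have R0 : 2%:R * (gre x)%:~R = 0 :> 'F_p.
  by rewrite -[RHS](addr0 0) -{1}E1 -E2; ring.
have re0 : (gre x)%:~R == 0 :> 'F_p.
  by move/eqP: R0; rewrite mulf_eq0 (negPf two_neq0).
split=> //; move/eqP: E1; rewrite (eqP re0) add0r mulf_eq0 (negPf j_neq0) //.
Qed.

(** The element 1 - ji has components 2 and 1 + j^2 = 0, so it isolates the first factor. *)
Lemma split_idempotent : exists w, phi w != 0 /\ phi (gbar w) = 0.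
Proof.
exists (Gauss 1 (- (j : nat)%:Z)); rewrite /phi /= opprK.
have -> : ((j : nat)%:Z)%:~R = j by rewrite -[LHS]/((j : nat)%:R) natr_Zp.
have -> : (- (j : nat)%:Z)%:~R = - j by rewrite rmorphN /= -[(_%:Z)%:~R]/((j : nat)%:R) natr_Zp.
rewrite mulrN -expr2 Hj opprK subrr; split=> //.
exact: two_neq0.
Qed.

(** [P] asks the conjugate component of y to annihilate the [phi] component of the image of [A]; [L]
    asks moreover that the [phi] component of x be annihilated by all such y. The two conditions are
    dual to each other, so [L] is p-selfdual, and it contains the columns of [A]. *)
Lemma split_factor (q : int) (A : 'M[gauss int]_3) : q != 0 -> (p %| q)%Z ->
  A *m A^h = (gC q)%:M ->
  exists B C : 'M_3, B *m B^h = (gC p%:Z)%:M /\ A = B *m C.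
Proof.
move=> q0 pq Aq; have [w [w1 w0]] := split_idempotent.
have phi_Aq x y : phi (gdot (A *m x) (A *m y)) = 0.
  apply: (proj1 ((phi_dvg _).1 _)).
  rewrite (gdot_image _ _ q0 Aq); apply: dvgM; apply/dvgP; rewrite greC gimC; split=> //; exact: dvdz0.
pose P (y : 'cV_3) := forall z, phi (gdot y (A *m z)) = 0.
pose L x := P x /\ forall y, P y -> phi (gdot y x) = 0.
have LA z : L (A *m z).
  by split=> [y|y]; [exact: phi_Aq | exact].
have Ldual x : L x <-> forall y, L y -> dvg p (gdot y x).
  split=> [[Px Lx] y [Py Ly]|dual].
    by apply/phi_dvg; rewrite -gdot_sym; split; [apply: Lx | apply: Ly].
  split=> [z|y Py].
    (* Multiplying the test vector by [w] kills its conjugate component, which puts it in [L]; the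
       factor [phi w] then cancels from the condition obtained. *)
    have Ly : L (w *: (A *m z)).
      split=> [z'|y Py]; first by rewrite gdotZl phiM w0 mul0r.
      by rewrite gdotZ phiM Py mulr0.
    have /dvg_bar := dual _ Ly; rewrite -gdot_sym gdotZ => /phi_dvg[/eqP + _].
    by rewrite phiM mulf_eq0 (negPf w1) => /eqP.
  have Ly : L (gbar w *: y).
    split=> [z|y' Py']; first by rewrite gdotZl phiM Py mulr0.
    by rewrite gdotZ phiM w0 mul0r.
  have := dual _ Ly; rewrite gdotZl gbarK => /phi_dvg[/eqP + _].
  by rewrite phiM mulf_eq0 (negPf w1) => /eqP.
have [|B [BB LB]] := @selfdual_lattice p L _ Ldual; first by rewrite ltz_nat prime_gt0.
have [i|C AE] := @factor_columns _ _ A B; last by exists B, C.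
by apply/LB; apply: LA.
Qed.
End Split.

Lemma gint_Fp_eq0 (x : gauss int) : gint 'F_p x = 0 <-> dvg p x.
Proof.
split=> [E|/dvgP[]].
  by apply/dvgP; rewrite -!intFp_eq0; split; apply/eqP; move: E => [].
by rewrite -!intFp_eq0 => /eqP Er /eqP Ei; apply: gaussP.
Qed.

Lemma gint_Fp_lift (y : 'cV[gauss 'F_p]_3) : exists x, map_mx (gint 'F_p) x = y.
Proof.
have lift1 (a : 'F_p) : ((a : nat)%:Z)%:~R = a by rewrite -[LHS]/((a : nat)%:R) natr_Zp.
exists (\col_i Gauss (gre (y i 0) : nat)%:Z (gim (y i 0) : nat)%:Z).
by apply/matrixP => i k; rewrite ord1 !mxE; apply: gaussP; rewrite /= lift1.
Qed.

Lemma gint_gdot (K : comNzRingType) (x y : 'cV[gauss int]_3) :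
  gint K (gdot x y) = ((map_mx (@gint K) x)^h *m map_mx (@gint K) y) 0 0.
Proof. by rewrite -map_gint_star -map_mxM mxE. Qed.

(** The lattice is A Z[i]^3 + p N, where N consists of the t with p dividing every (A z)^h t. All
    pairings between its members are divisible by p^2, and it contains the columns of [A]. *)
Lemma inert_factor (q : int) (A : 'M[gauss int]_3) : q != 0 -> ((p * p)%N %| q)%Z ->
  A *m A^h = (gC q)%:M ->
  exists B C : 'M_3, B *m B^h = (gC (p * p)%N%:Z)%:M /\ A = B *m C.
Proof.
move=> q0 pq Aq; have p0 : p%:Z != 0 by rewrite eqz_nat -lt0n prime_gt0.
have gA x y : dvg (p * p)%N (gdot (A *m x) (A *m y)).
  rewrite (gdot_image _ _ q0 Aq); apply: dvgM; apply/dvgP; rewrite greC gimC.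
  by split; [exact: pq | exact: dvdz0].
have dvg_pp x y : dvg p x -> dvg p y -> dvg (p * p)%N (x * y).
  by move=> [a ->] [b ->]; exists (a * b); rewrite PoszM rmorphM; ring.
have dvg_p2 x : dvg (p * p)%N (gC p%:Z * x) <-> dvg p x.
  split=> [[y E]|[y ->]]; exists y; last by rewrite PoszM rmorphM mulrA.
  apply/eqP; rewrite -subr_eq0; apply/eqP; apply: (gC_mul_eq0 p0).
  by rewrite mulrBr E PoszM rmorphM; ring.
pose P (t : 'cV[gauss int]_3) := forall z, dvg p (gdot (A *m z) t).
pose L x := exists z t, x = A *m z + gC p%:Z *: t /\ P t.
have LA z : L (A *m z).
  exists z, 0; rewrite scaler0 addr0; split=> // y.
  by exists 0; rewrite /gdot mulmx0 mxE mulr0.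
have Ldual x : L x <-> forall y, L y -> dvg (p * p)%N (gdot y x).
  split=> [[z [t [-> Pt]]] y [z' [t' [-> Pt']]]|dual].
    rewrite !gdotD !gdotDl !gdotZ !gdotZl gbarC.
    apply: dvgD; apply: dvgD.
    - exact: gA.
    - by apply/dvg_p2; rewrite gdot_sym; apply: dvg_bar.
    - by apply/dvg_p2.
    - by apply/dvg_p2; exists (gdot t' t).
  (* If A^h t = 0 modulo p, then p t lies in [L], so p^2 divides p t^h x. Thus x is orthogonal to
     the kernel of [A^h] modulo p and lies in the image of [A] there. *)
  have [z' Hz'] : exists z, map_mx (gint 'F_p) x = map_mx (gint 'F_p) A *m z.
    apply: image_of_biorthogonal => t' At'; have [t Et] := gint_Fp_lift t'.
    rewrite -Et -gint_gdot; apply/gint_Fp_eq0.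
    have Pt : P t.
      move=> z; apply/gint_Fp_eq0; rewrite gint_gdot map_mxM mxstarM -mulmxA Et At'.
      by rewrite mulmx0 mxE.
    apply/dvg_p2; rewrite -[gC _]gbarC -gdotZl; apply: dual.
    by exists 0, t; rewrite mulmx0 add0r.
  have [z Ez] := gint_Fp_lift z'.
  have /fin_choice[s Hs] : forall i : 'I_3, dvg p ((x - A *m z) i 0).
    move=> i; apply/gint_Fp_eq0.
    have -> : gint 'F_p ((x - A *m z) i 0) = (map_mx (gint 'F_p) (x - A *m z)) i 0 by rewrite [RHS]mxE.
    by rewrite map_mxB map_mxM Ez -Hz' subrr mxE.
  have Ex : x = A *m z + gC p%:Z *: \col_i s i.
    apply/matrixP => i k; rewrite ord1 mxE [X in _ + X]mxE [X in _ + _ * X]mxE -Hs.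
    by rewrite mxBE addrC subrK.
  (* The remainder x - A z = p s pairs with each A y to a multiple of p^2, so s satisfies [P]. *)
  exists z, (\col_i s i); split=> // y; apply/dvg_p2; rewrite -gdotZ.
  have -> : gC p%:Z *: (\col_i s i) = x + A *m (- z).
    by rewrite Ex mulmxN addrAC subrr add0r.
  by rewrite gdotD; apply: dvgD; [apply: dual; apply: LA | apply: gA].
have [|B [BB LB]] := @selfdual_lattice (p * p)%N L _ Ldual.
  by rewrite ltz_nat muln_gt0 prime_gt0.
have [i|C AE] := @factor_columns _ _ A B; last by exists B, C.
by apply/LB; apply: LA.
Qed.
End ModP.

(** Multiplying A A^h by [B^h] on the left and [B] on the right gives r^2 C C^h = r^2 m, from which
    r^2 cancels. *)
Lemma cofactor_gram (r m : int) (A B C : 'M[gauss int]_3) : r != 0 ->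
  B *m B^h = (gC r)%:M -> A = B *m C -> A *m A^h = (gC (r * m))%:M -> C *m C^h = (gC m)%:M.
Proof.
move=> r0 BB -> AA; have B'B := scal_mulmxC r0 BB.
have E : gC (r * r) *: (C *m C^h) = gC (r * r) *: (gC m)%:M.
  transitivity (B^h *m (B *m C *m (B *m C)^h) *m B).
    rewrite mxstarM !mulmxA B'B -!mulmxA B'B !mulmxA mul_scalar_mx mul_mx_scalar -scalemxAl scalerA.
    by rewrite rmorphM.
  rewrite AA mul_mx_scalar -scalemxAl B'B !scale_scalar_mx -!rmorphM /=.
  by congr (gC _)%:M; ring.
apply/matrixP => i j; apply/eqP; rewrite -subr_eq0; apply/eqP.
apply: (@gC_mul_eq0 _ (r * r)); first by rewrite mulf_neq0.
rewrite mulrBr; apply/eqP; rewrite subr_eq0; apply/eqP.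
by have /matrixP/(_ i j) := E; rewrite mxE [RHS]mxE.
Qed.

Lemma pprime_factor (p e : nat) (A : 'M[gauss int]_3) : prime p -> odd p ->
  A *m A^h = (gC (p ^ e.+1)%N%:Z)%:M ->
  exists (B C : 'M[gauss int]_3) (e' : nat), [/\ (e' <= e)%N, B *m B^h = (gC (pprime p)%:Z)%:M,
    A = B *m C & C *m C^h = (gC (p ^ e')%N%:Z)%:M].
Proof.
move=> Hp Hodd AA; have p0 : (0 < p)%N by apply: prime_gt0.
have q0 : (p ^ e.+1)%N%:Z != 0 by rewrite eqz_nat -lt0n expn_gt0 p0.
rewrite /pprime; case: eqP => p1.
  have [j Hj] := sqrt_opp1 Hp p1.
  have [|B [C [BB AE]]] := split_factor Hp Hj Hodd q0 _ AA.
    by rewrite expnS PoszM dvdz_mulr // dvdzz.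
  exists B, C, e; split=> //; apply: (cofactor_gram _ BB AE); first by rewrite eqz_nat -lt0n.
  by rewrite -PoszM -expnS.
case: e => [|e] in AA q0 *; last first.
  have [|B [C [BB AE]]] := inert_factor Hp q0 _ AA.
    by rewrite !expnS mulnA PoszM dvdz_mulr // dvdzz.
  exists B, C, e; split=> //.
  apply: (cofactor_gram _ BB AE); first by rewrite eqz_nat -lt0n muln_gt0 p0.
  by rewrite -PoszM AA !expnS mulnA.
(* Exponent 1 is impossible for p = 3 modulo 4: det A would have norm p^3, which is 3 modulo 4 and
   not a sum of two squares. *)
have p3 : (p %% 4 = 3)%N.
  by move: Hodd p1; lia.
have : gN (\det A) = (p ^ 3)%N%:Z.
  apply: gC_inj; rewrite -mul_gbar -det_mxstar -det_mulmx AA det_scalar -rmorphXn /=.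
  by rewrite expn1 -!natz natrX.
rewrite /gN; set x := gre _; set y := gim _ => E.
have p4 : (p ^ 3 = 3 %[mod 4])%N by rewrite -modnXm p3.
have sq (z : int) : exists k, z ^+ 2 = 4 * k \/ z ^+ 2 = 4 * k + 1.
  have [a [->|->]] : exists a, z = 2 * a \/ z = 2 * a + 1 by exists (z %/ 2)%Z; lia.
    by exists (a ^+ 2); left; ring.
  by exists (a ^+ 2 + a); right; ring.
move: E; have [k Hk] := sq x; have [l Hl] := sq y.
by move: p4; set P := (p ^ 3)%N; case: Hk => ->; case: Hl => ->; lia.
Qed.

(** * The action of Lambda_p *)

Section Global.
Variables (p : nat) (Hp : prime p) (Hodd : odd p).

Definition LamM (X : 'M[gauss rat]_3) := Lam p (ofM X).

Lemma LamM_toM g : Lam p g -> LamM (toM g).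
Proof. by rewrite /LamM toMK. Qed.

Lemma ofM_mul (R : comNzRingType) (A B : 'M[gauss R]_3) : ofM (A *m B) = gmul (ofM A) (ofM B).
Proof. by apply: (can_inj (@toMK R)); rewrite toM_mul !ofMK. Qed.
Lemma ofM_star (R : comNzRingType) (A : 'M[gauss R]_3) : ofM A^h = gstar (ofM A).
Proof. by apply: (can_inj (@toMK R)); rewrite toM_star !ofMK. Qed.

Lemma LamM_mul X Y : LamM X -> LamM Y -> LamM (X *m Y).
Proof. by rewrite /LamM ofM_mul; apply: Lam_mul. Qed.
Lemma LamM_star X : LamM X -> LamM X^h.
Proof. by rewrite /LamM ofM_star; apply: Lam_inv. Qed.
Lemma LamM_one : LamM 1%:M.
Proof. by rewrite -(toM_one rat); apply: LamM_toM; apply: Lam_one. Qed.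

Lemma toM_int2rat (A : gmx int) : toM (gmap int2rat A) = map_mx (@gint rat) (toM A).
Proof. by apply/matrixP => i j; rewrite !mxE; apply: gaussP. Qed.

Lemma LamM_gen (A : 'M[gauss int]_3) : primary_mx (pprime p) A -> (forall a, A <> a%:M) ->
  LamM (map_mx (@gint rat) A).
Proof.
move=> [AA Ad] Ans; rewrite -(ofMK A) -toM_int2rat; apply: LamM_toM; apply: Lam_gen; split.
- by apply: (can_inj (@toMK _)); rewrite toM_mul toM_star ofMK toM_scal.
- move=> [a [b E]]; apply: (Ans (Gauss a b)); rewrite -(ofMK A) E.
  by apply/matrixP => i j; rewrite !mxE; case: eqP => _; apply: gaussP.
- by move=> i; rewrite !mxE; apply/primaryE.
Qed.

Lemma pprime_pow : exists e : nat, pprime p = (p ^ e)%N.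
Proof. by rewrite /pprime; case: eqP => _; [exists 1%N; rewrite expn1 | exists 2%N]. Qed.

Lemma pprime_mod4 : exists s : int, (pprime p)%:Z = 1 + 4 * s.
Proof.
exists (pprime p %/ 4)%N%:Z; rewrite /pprime.
suff : ((if p %% 4 == 1 then p else p ^ 2) %% 4 = 1)%N by lia.
case: eqP => // p1; have p3 : (p %% 4 = 3)%N by move: Hodd p1; lia.
by rewrite -modnXm p3.
Qed.

Lemma pprime_odd : (pprime p)%:Z%:~R != 0 :> 'F_2.
Proof.
have [s ->] := pprime_mod4; rewrite intrD intrM (_ : 4%:~R = 0) ?mul0r ?addr0 ?oner_neq0 //.
exact/eqP.
Qed.

Lemma pprime_neq0 : (pprime p)%:Z != 0.
Proof. by have [s ->] := pprime_mod4; lia. Qed.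

Lemma gint_neq0_inv (a : gauss int) (q : int) : q != 0 -> gN a = q ->
  gint rat a * (gC (q%:~R)^-1 * gint rat (gbar a)) = 1.
Proof.
move=> q0 Na; rewrite mulrCA -rmorphM /= mul_gbar Na gintC -rmorphM /= mulVf ?rmorph1 //.
by rewrite intr_eq0.
Qed.

(** Strong induction, since a factor of norm p^2 lowers e by two. In A = (B W0)(W0^h C) the first
    factor is primary of multiplier p', hence a generator or scalar, and the second has a smaller
    exponent. At e = 0 the matrix is unitary and serves as [W]. *)
Lemma orbit_of_similitude (e : nat) (A : 'M[gauss int]_3) : A *m A^h = (gC (p ^ e)%N%:Z)%:M ->
  exists X c d (W : 'M[gauss int]_3), [/\ LamM X, c * d = 1, W *m W^h = 1%:M &
    map_mx (@gint rat) A = c *: (X *m map_mx (@gint rat) W)].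
Proof.
have [n] := ubnP e; elim: n e A => // n IHn [|e] A; rewrite ltnS => en AA.
  exists 1%:M, 1, 1, A; split; rewrite ?mulr1 ?mul1mx ?scale1r //; first exact: LamM_one.
have [B [C [e' [e'e BB -> CC]]]] := pprime_factor Hp Hodd AA.
have [W0 [WW Bprim]] := primary_normalization pprime_odd BB.
have WW' : W0^h *m W0 = 1%:M by apply: mulmx1C.
have [|X [c [d [W [LX cd WU EX]]]]] := IHn e' (W0^h *m C) (leq_ltn_trans e'e en).
  rewrite mxstarM mxstarK mulmxA -[W0^h *m C *m _]mulmxA CC mul_mx_scalar -scalemxAl WW'.
  by rewrite scale_scalar_mx mulr1.
have EA : map_mx (@gint rat) (B *m C) =
    c *: (map_mx (@gint rat) (B *m W0) *m X *m map_mx (@gint rat) W).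
  have -> : B *m C = B *m W0 *m (W0^h *m C) by rewrite mulmxA -[B *m W0 *m _]mulmxA WW mulmx1.
  by rewrite map_mxM EX -scalemxAr mulmxA.
have [[b Eb]|Bns] := classic (exists b, B *m W0 = b%:M); last first.
  exists (map_mx (@gint rat) (B *m W0) *m X), c, d, W; split=> //.
  by apply: LamM_mul => //; apply: LamM_gen => // a Ea; apply: Bns; exists a.
have Nb : gN b = pprime p.
  apply: gC_inj; case: Bprim => + _; rewrite Eb mxstar_scalar mul_scalar_mx scale_scalar_mx mul_gbar.
  by move/matrixP/(_ o0 o0); rewrite !mxE eqxx !mulr1n.
(* A scalar first factor b is absorbed into c; its inverse is conj(b) / p'. *)
exists X, (c * gint rat b), (d * (gC ((pprime p)%:Z%:~R)^-1 * gint rat (gbar b))), W; split=> //.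
  by rewrite mulrACA cd mul1r (gint_neq0_inv pprime_neq0 Nb).
by rewrite EA Eb map_scalar_mx /= mul_scalar_mx -scalemxAl scalerA.
Qed.

(** * Units of Z[1/p][i] and normal forms of elements of Lambda_p *)

Definition ZinvG (x : gauss rat) := Zinv p (gre x) /\ Zinv p (gim x).
Definition Zinv_unit (x : gauss rat) := ZinvG x /\ exists y, ZinvG y /\ x * y = 1.

Lemma pX_neq0 k : (p ^ k)%:R != 0 :> rat.
Proof. by rewrite pnatr_eq0 -lt0n expn_gt0 prime_gt0. Qed.

Lemma ZinvD x y : Zinv p x -> Zinv p y -> Zinv p (x + y).
Proof.
move=> [a [k ->]] [b [l ->]]; exists (a * (p ^ l)%N + b * (p ^ k)%N), (k + l)%N.
rewrite addf_div ?pX_neq0 // rmorphD !rmorphM /= expnD natrM.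
by rewrite -[(Posz (p ^ l))%:~R]/((p ^ l)%:R) -[(Posz (p ^ k))%:~R]/((p ^ k)%:R).
Qed.

Lemma ZinvM x y : Zinv p x -> Zinv p y -> Zinv p (x * y).
Proof.
move=> [a [k ->]] [b [l ->]]; exists (a * b), (k + l)%N.
by rewrite mulf_div rmorphM expnD natrM.
Qed.

Lemma Zinv_int (z : int) : Zinv p z%:~R.
Proof. by exists z, 0%N; rewrite divr1. Qed.

Lemma ZinvN x : Zinv p x -> Zinv p (- x).
Proof. by move=> [a [k ->]]; exists (- a), k; rewrite rmorphN mulNr. Qed.

Lemma ZinvG_mul x y : ZinvG x -> ZinvG y -> ZinvG (x * y).
Proof.
move=> [? ?] [? ?]; split; rewrite /=; apply: ZinvD; try apply: ZinvN; exact: ZinvM.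
Qed.

Lemma ZinvG_bar x : ZinvG x -> ZinvG (gbar x).
Proof. by move=> [? ?]; split=> //; apply: ZinvN. Qed.

Lemma ZinvG_int x : ZinvG (gint rat x).
Proof. by split; exact: Zinv_int. Qed.

Lemma Zinv_unitM x y : Zinv_unit x -> Zinv_unit y -> Zinv_unit (x * y).
Proof.
move=> [x0 [x' [x'0 xx]]] [y0 [y' [y'0 yy]]]; split; first exact: ZinvG_mul.
by exists (x' * y'); split; [exact: ZinvG_mul | rewrite mulrACA xx yy mulr1].
Qed.

Lemma Zinv_unit_bar x : Zinv_unit x -> Zinv_unit (gbar x).
Proof.
move=> [x0 [x' [x'0 xx]]]; split; first exact: ZinvG_bar.
by exists (gbar x'); split; [exact: ZinvG_bar | rewrite -rmorphM xx rmorph1].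
Qed.

Lemma Zinv_unit_inv x : Zinv_unit x -> exists y, Zinv_unit y /\ x * y = 1.
Proof.
by move=> [x0 [y [y0 xy]]]; exists y; split=> //; split=> //; exists x; split=> //; rewrite mulrC.
Qed.

Lemma Zinv_unit1 : Zinv_unit 1.
Proof.
have Z1 : ZinvG 1 by rewrite -(rmorph1 (@gint rat)); exact: ZinvG_int.
by split=> //; exists 1; split=> //; rewrite mulr1.
Qed.

Lemma Zinv_unit_gint (a : gauss int) (e : nat) : gN a = (p ^ e)%N -> Zinv_unit (gint rat a).
Proof.
move=> Na; split; first exact: ZinvG_int.
exists (gC ((p ^ e)%N%:Z%:~R)^-1 * gint rat (gbar a)); split; last first.
  by apply: gint_neq0_inv => //; rewrite eqz_nat -lt0n expn_gt0 prime_gt0.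
apply: ZinvG_mul; last exact: ZinvG_int.
split; first by exists 1, e; rewrite mul1r.
exact: (Zinv_int 0).
Qed.

Lemma Zinv_unit_pX e : Zinv_unit (gC (p ^ e)%:R).
Proof.
rewrite -[gC _]mulr1; have -> : gC (p ^ e)%:R * 1 = gint rat (gC (p ^ e)%N%:Z).
  by rewrite mulr1 gintC.
by apply: (@Zinv_unit_gint _ (e * 2)); rewrite gNC expnM -!natz !natrX.
Qed.

(** Generators have this shape, and it survives products by [primary_mx_mul], adjoints by
    [primary_mx_star], and unit scalars. *)
Lemma Lam_primary g : Lam p g -> exists c (A : 'M[gauss int]_3) e,
  [/\ Zinv_unit c, toM g = c *: map_mx (@gint rat) A, primary_mx (p ^ e)%N A &
    exists s : int, (p ^ e)%N%:Z = 1 + 4 * s].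
Proof.
have pX0 e : (p ^ e)%N%:Z != 0 by rewrite eqz_nat -lt0n expn_gt0 prime_gt0.
elim=> {g}.
- move=> A [AA _ Ad]; have [e pe] := pprime_pow.
  exists 1, (toM A), e; rewrite scale1r toM_int2rat -pe; split=> //.
  + exact: Zinv_unit1.
  + split; first by rewrite -toM_star -toM_mul AA toM_scal.
    by move=> i; rewrite mxE; apply/primaryE; apply: Ad.
  + exact: pprime_mod4.
- exists 1, 1%:M, 0%N; split; first exact: Zinv_unit1.
  + by rewrite toM_one map_scalar_mx rmorph1 scale1r.
  + split; first by rewrite mul1mx; exact: (mxstar_gC 3 (1 : int)).
    by move=> i; rewrite mxE eqxx mulr1n; exists 0; rewrite subrr mulr0.
  + by exists 0.
- move=> x y _ [c [A [e [cu Ex Ap es]]]] _ [d [B [f [du Ey Bp fs]]]].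
  exists (c * d), (A *m B), (e + f)%N; split; first exact: Zinv_unitM.
  + by rewrite toM_mul Ex Ey -scalemxAl -scalemxAr scalerA -map_mxM.
  + by rewrite expnD PoszM; apply: primary_mx_mul.
  + case: es fs => [s Es] [t Et]; exists (s + t + 4 * s * t).
    by rewrite expnD PoszM Es Et; ring.
- move=> x _ [c [A [e [cu Ex Ap es]]]]; exists (gbar c), A^h, e; split=> //.
  + exact: Zinv_unit_bar.
  + by rewrite toM_star Ex mxstarZ map_gint_star.
  + exact: primary_mx_star.
- move=> x y _ [c [A [e [cu Ex Ap es]]]] [[a b] [[a0 [b0 [[a' b'] [a'0 [b'0 [E1 E2]]]]]] ->]].
  exists (Gauss a b * c), A, e; split=> //; last by rewrite toM_sc Ex scalerA.
  apply: Zinv_unitM => //; split=> //; exists (Gauss a' b'); split=> //.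
  by apply: gaussP.
Qed.

(** This makes the adjoint an inverse on both sides up to a unit scalar. *)
Lemma Lam_similitude g : Lam p g -> exists m, [/\ Zinv_unit m,
  toM g *m (toM g)^h = m%:M & (toM g)^h *m toM g = m%:M].
Proof.
move=> /Lam_primary[c [A [e [cu -> [AA _] _]]]].
have q0 : (p ^ e)%N%:Z != 0 by rewrite eqz_nat -lt0n expn_gt0 prime_gt0.
exists (c * gbar c * gC (p ^ e)%:R); split.
- by apply: Zinv_unitM; [apply: Zinv_unitM => //; exact: Zinv_unit_bar | exact: Zinv_unit_pX].
- rewrite mxstarZ -scalemxAl -scalemxAr -map_gint_star -map_mxM AA map_scalar_mx /= gintC.
  by rewrite !scale_scalar_mx mulrA.
- rewrite mxstarZ -scalemxAl -scalemxAr -map_gint_star -map_mxM (scal_mulmxC q0 AA).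
  by rewrite map_scalar_mx /= gintC !scale_scalar_mx mulrCA mulrA.
Qed.

(** * The action on vertices over Q_p *)

Section Action.
Variables (K : fieldType) (iota : {rmorphism rat -> K}) (v : K -> int).
Hypothesis HK : is_Qp p iota v.

Notation mapK := (map_mx (gmapc iota)).

Lemma mapK_gint m n (A : 'M_(m, n)) : mapK (map_mx (@gint rat) A) = map_mx (@gint K) A.
Proof.
by apply/matrixP => i j; rewrite !mxE; apply: gaussP; rewrite /= rmorph_int.
Qed.

(** The orbit of the base vertex is everything: [g] has the vertex of an integral similitude, which
    is X W up to a scalar with [W] unitary over Z[i], and such a [W] fixes the base vertex. *)
Lemma Lam_vertex (g : 'M[gauss K]_3) (l : K) : l != 0 -> g *m g^h = (gC l)%:M ->
  exists X, LamM X /\ same_vertex v g (mapK X).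
Proof.
move=> l0 gl; have [A [e [AA gA]]] := GU_vertex Hp HK l0 gl.
have [X [c [d [W [LX cd WW EX]]]]] := orbit_of_similitude AA.
exists X; split=> //; apply: (same_vertex_trans Hp HK gA).
apply: (same_vertex_sym Hp HK); exists (gmapc iota c), (gmapc iota d), (map_mx (@gint K) W).
split; first by rewrite -rmorphM cd rmorph1.
split; last by rewrite -mapK_gint EX map_mxZ map_mxM mapK_gint.
split=> [i j|]; first by rewrite mxE; exact: (gval_int Hp HK).
exists 1; split; last by rewrite -map_gint_star -map_mxM WW map_mx1.
have Z1 : Defs.Zp v 1 by exact: (val_ge_one Hp HK).
by split=> //; exists 1; rewrite mulr1.
Qed.

(** Freeness at the base vertex: the primary representative satisfies the divisibilities of
    [stabilizer_dvg], hence is scalar. *)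
Lemma Lam_stabilizer g : Lam p g -> same_vertex v 1%:M (mapK (toM g)) ->
  exists a, Zinv_unit a /\ toM g = a%:M.
Proof.
move=> /Lam_primary[c [A [e [cu Eg Ap es]]]] Hv.
have q0 : 0 < (p ^ e)%N%:Z by rewrite ltz_nat expn_gt0 prime_gt0.
case: (cu) => _ [d [_ cd]].
have HA : same_vertex v 1%:M (map_mx (@gint K) A).
  apply: (same_vertex_trans Hp HK Hv); rewrite Eg map_mxZ mapK_gint.
  apply: (same_vertex_sym Hp HK).
  by apply: (@same_vertex_scale _ Hp _ _ _ HK _ _ (gmapc iota d)); rewrite -rmorphM cd rmorph1.
have Hd := stabilizer_dvg Hp HK Ap.1 HA.
have [a Ea] := primary_scalar q0 es Ap Hd.
exists (c * gint rat a); split; last by rewrite Eg Ea map_scalar_mx scale_scalar_mx.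
apply: Zinv_unitM => //; apply: (@Zinv_unit_gint _ e).
apply: gC_inj; case: Ap => + _; rewrite Ea mxstar_scalar mul_scalar_mx scale_scalar_mx mul_gbar.
by move/matrixP/(_ o0 o0); rewrite !mxE eqxx !mulr1n.
Qed.

Lemma vertex_eqE (g h : gmx K) : vertex_eq v g h <-> same_vertex v (toM g) (toM h).
Proof.
have GUE k : GU (Defs.Zp v) k <-> GUM (Defs.Zp v) (toM k).
  split=> -[k0 [l [lu kk]]]; split.
  - by move=> i j; rewrite mxE; apply: k0.
  - by exists l; rewrite -toM_star -toM_mul kk toM_scal.
  - by move=> i j; have := k0 i j; rewrite mxE.
  - exists l; split=> //; apply: (can_inj (@toMK _)).
    by rewrite toM_mul toM_star kk toM_scal.
split=> [[[a b] [k [[_ [_ [[a' b'] [_ [_ [E1 E2]]]]]] [/GUE Hk ->]]]]|].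
  exists (Gauss a b), (Gauss a' b'), (toM k); split; first exact: gaussP.
  by rewrite toM_sc toM_mul.
move=> [[a b] [[a' b'] [k [E [Hk Eh]]]]]; exists (a, b), (ofM k); split.
  split=> //; split=> //; exists (a', b'); split=> //; split=> //.
  by case: E => E1 E2; congr pair.
split; first by apply/GUE; rewrite ofMK.
by apply: (can_inj (@toMK _)); rewrite toM_sc toM_mul ofMK.
Qed.

Lemma PGU_eqE c (x y : gmx rat) : Zinv_unit c -> toM y = c *: toM x -> PGU_eq (Zinv p) x y.
Proof.
case: c => a b [[a0 b0] [[a' b'] [[a'0 b'0] E]]] Exy; exists (a, b); split.
  split=> //; split=> //; exists (a', b'); split=> //; split=> //.
  by case: E => E1 E2; congr pair.
by apply: (can_inj (@toMK _)); rewrite toM_sc.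
Qed.

Lemma GU_toM (g : gmx K) : GU (fun _ => True) g -> exists l, l != 0 /\ toM g *m (toM g)^h = (gC l)%:M.
Proof.
move=> [_ [l [[_ [l' [_ ll']]] gl]]]; exists l; split; last by rewrite -toM_star -toM_mul gl toM_scal.
by apply/eqP => E; move/eqP: ll'; rewrite E mul0r eq_sym oner_eq0.
Qed.

Lemma mapK_star m n (A : 'M_(m, n)) : mapK A^h = (mapK A)^h.
Proof. exact: map_mxstar. Qed.

Lemma simply_transitive (g h : gmx K) :
  GU (fun _ : K => True) g -> GU (fun _ : K => True) h ->
  (exists gam, Lam p gam /\ vertex_eq v (gmul (gmap iota gam) g) h) /\
  (forall gam1 gam2, Lam p gam1 -> Lam p gam2 ->
     vertex_eq v (gmul (gmap iota gam1) g) h ->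
     vertex_eq v (gmul (gmap iota gam2) g) h ->
     PGU_eq (Zinv p) gam1 gam2).
Proof.
move=> /GU_toM[l [l0 gl]] /GU_toM[m [m0 hm]].
have [X [LX gX]] := Lam_vertex l0 gl.
have [Y [LY hY]] := Lam_vertex m0 hm.
have Hsym := same_vertex_sym Hp HK.
split.
  (* With g = X o and h = Y o for the base vertex o, this element sends g to Y X^h X o = h, as X^h X
     is scalar. *)
  exists (ofM (Y *m X^h)); split; first by apply: LamM_mul => //; apply: LamM_star.
  apply/vertex_eqE; rewrite toM_mul toM_map ofMK.
  apply: (same_vertex_trans Hp HK (same_vertex_mull _ gX)).
  have [mu [[_ [mu' [_ mumu]]] _]] := Lam_similitude LX; rewrite ofMK => XX.
  rewrite -map_mxM -mulmxA XX mul_mx_scalar map_mxZ.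
  apply: (same_vertex_trans Hp HK _ (Hsym _ _ hY)); apply: (Hsym).
  by apply: (@same_vertex_scale _ Hp _ _ _ HK _ _ (gmapc iota mu')); rewrite -rmorphM mumu rmorph1.
move=> x y Lx Ly /vertex_eqE + /vertex_eqE; rewrite !toM_mul !toM_map => Hx Hy.
have XY : same_vertex v (mapK (toM y *m X)) (mapK (toM x *m X)).
  rewrite !map_mxM; apply: (same_vertex_trans Hp HK (same_vertex_mull _ (Hsym _ _ gX))).
  apply: (same_vertex_trans Hp HK Hy); apply: (same_vertex_trans Hp HK (Hsym _ _ Hx)).
  exact: (@same_vertex_mull K v (mapK (toM x)) _ _ gX).
have LyX : LamM (toM y *m X) by apply: LamM_mul => //; apply: LamM_toM.
have LxX : LamM (toM x *m X) by apply: LamM_mul => //; apply: LamM_toM.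
have [mu [mu_unit]] := Lam_similitude LyX; rewrite ofMK => EyX EyX'.
(* Up to a scalar this is (y X)^-1 (x X), which fixes the base vertex because x X and y X both send
   it to h. *)
pose delta := (toM y *m X)^h *m (toM x *m X).
have Ldelta : LamM delta by apply: LamM_mul => //; apply: LamM_star.
have [|a [au]] := Lam_stabilizer Ldelta.
  rewrite ofMK map_mxM mapK_star; apply: (same_vertex_trans Hp HK _ (same_vertex_mull _ XY)).
  rewrite -mapK_star -map_mxM EyX' map_scalar_mx -[X in same_vertex _ _ X]scalemx1.
  case: mu_unit => _ [mu' [_ mumu]].
  by apply: (@same_vertex_scale _ Hp _ _ _ HK _ _ (gmapc iota mu')); rewrite -rmorphM mumu rmorph1.
rewrite ofMK => Edelta.
have E : mu *: (toM x *m X) = a *: (toM y *m X).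
  have <- : (toM y *m X) *m delta = a *: (toM y *m X) by rewrite Edelta mul_mx_scalar.
  by rewrite /delta [RHS](mulmxA (toM y *m X)) EyX mul_scalar_mx.
have [nu [nu_unit XX _]] := Lam_similitude LX; rewrite ofMK in XX.
have [nu' [_ nunu]] := Zinv_unit_inv nu_unit; have [a' [a'u aa]] := Zinv_unit_inv au.
(* [X] is cancelled by multiplying on the right by [X^h] and dividing by the unit nu. *)
have E2 : mu *: toM x = a *: toM y.
  have : (mu *: (toM x *m X)) *m X^h = (a *: (toM y *m X)) *m X^h by rewrite E.
  rewrite -!scalemxAl -!mulmxA XX !mul_mx_scalar !scalerA => /(congr1 ( *:%R nu')).
  by rewrite !scalerA ![nu' * (_ * _)]mulrCA ![nu' * _]mulrC nunu !mulr1.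
apply: (@PGU_eqE (a' * mu)); first exact: Zinv_unitM.
by rewrite -scalerA E2 scalerA mulrC aa scale1r.
Qed.
End Action.
End Global.

(* Lambda_p acts simply transitively on the special vertices
   PGU_3(Q_p)/PGU_3(Z_p), the action of gam being [g] |-> [gam g]. *)
Theorem theorem1p2 (p : nat) (Hp : prime p) (Hodd : odd p)
    (K : fieldType) (iota : {rmorphism rat -> K}) (v : K -> int)
    (HK : is_Qp p iota v) :
  forall g h : gmx K,
    GU (fun _ : K => True) g -> GU (fun _ : K => True) h ->
    (exists gam, Lam p gam /\ vertex_eq v (gmul (gmap iota gam) g) h) /\
    (forall gam1 gam2, Lam p gam1 -> Lam p gam2 ->
       vertex_eq v (gmul (gmap iota gam1) g) h ->
       vertex_eq v (gmul (gmap iota gam2) g) h ->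
       PGU_eq (Zinv p) gam1 gam2).
Proof. exact: (simply_transitive Hp Hodd HK). Qed.
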